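(* Let $G$ be a Lie group with Lie algebra $\mathfrak{g}$, and let $P=\mathfrak{g}\times G$ be the trivial right principal $G$-bundle over $\mathfrak{g}$. Then the family of subspaces $$H_{(x,g)}=\{(v,T_1R_g(v)) \mid v\in\mathfrak{g}\}\subset T_{(x,g)}P=\mathfrak{g}\times T_gG,\qquad (x,g)\in P,$$ is the family of horizontal spaces of a connection on $P$ (the natural connection), and its local curvature 2-form $\Omega$ with respect to the identity section $\iota:\mathfrak{g}\to P$, $x\mapsto(x,1)$, is the constant $\mathfrak{g}$-valued 2-form on $\mathfrak{g}$ given, for every $x\in\mathfrak{g}$ and all tangent vectors $\xi,\eta\in T_x\mathfrak{g}\cong\mathfrak{g}$, by $$\Omega_x(\xi,\eta)=[\xi,\eta],$$ where $[\cdot,\cdot]$ is the Lie bracket of $\mathfrak{g}$.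
   Context: $\mathfrak{g}$ is identified with $T_1G$, with the usual bracket (that of left-invariant vector fields). The bundle projection is $P\to\mathfrak{g}$, $(x,g)\mapsto x$, and $G$ acts on $P$ on the right by $(x,h)\cdot g=(x,hg)$; this action map is also denoted $R_g:P\to P$. On $G$, $L_g(h)=gh$ and $R_g(h)=hg$, and $T_1R_g:\mathfrak{g}\to T_gG$ is the derivative of $R_g$ at the identity $1$. $\mathrm{Ad}_g=T_1(L_g\circ R_{g^{-1}}):\mathfrak{g}\to\mathfrak{g}$. A connection on a right principal $G$-bundle $P$ is a smooth $G$-equivariant distribution of horizontal subspaces of $TP$ complementary to the vertical tangent spaces of the fibers. For $\xi\in\mathfrak{g}$ the fundamental vector field is $\tilde\xi(p)=\frac{d}{dt}\big(p\cdot\exp(t\xi)\big)\big|_{t=0}$. The connection 1-form is the $\mathfrak{g}$-valued 1-form $\alpha$ on $P$ whose kernel at each point is the horizontal space and which satisfies $\alpha(\tilde\xi)=\xi$ for all $\xi\in\mathfrak{g}$ and $R_g^*\alpha=\mathrm{Ad}_{g^{-1}}\circ\alpha$ for all $g\in G$. The local connection 1-form with respect to $\iota$ is $\omega=\iota^*\alpha$, and the local curvature 2-form is $\Omega=d\omega+\frac12[\omega,\omega]$, where $[\omega,\omega](\xi,\eta)=[\omega(\xi),\omega(\eta)]-[\omega(\eta),\omega(\xi)]$. ''Constant'' means that $\Omega_x$ does not depend on $x$ under the identification $T_x\mathfrak{g}\cong\mathfrak{g}$. *)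

(* Defs.v *)
From HB Require Import structures.
From mathcomp Require Import all_boot all_order all_algebra.
From mathcomp Require Import all_classical all_reals all_analysis.

Set Implicit Arguments.
Unset Strict Implicit.
Unset Printing Implicit Defensive.

Import Order.TTheory GRing.Theory Num.Theory.
Import numFieldNormedType.Exports.

Local Open Scope classical_set_scope.
Local Open Scope ring_scope.

(* The model spaces used below are finite dimensional (row vectors and
   products of such), where C^(k+1) amounts to: differentiable, with all the
   directional derivatives [x |-> 'd f x v], for constant v, of class C^k.
   The notion is stated at a point so that no open domain has to be carried
   around; on an open set, "Ck k f x for all k at all points x" is the usual
   smoothness of f. *)
Fixpoint Ck (R : realType) (E F : normedModType R) (k : nat) (f : E -> F)
    (x : E) : Prop :=
  match k with
  | 0 => {for x, continuous f}
  | k'.+1 => (\forall y \near x, differentiable f y) /\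
             (forall v : E, Ck k' (fun y => 'd f y v) x)
  end.

Definition smooth_on (R : realType) (E F : normedModType R) (U : set E)
    (f : E -> F) : Prop :=
  forall x, U x -> forall k, Ck k f x.

Section SmoothLemmas.
Context {R : realType}.
Implicit Types E F : normedModType R.

Lemma near_eq_diffP E F (f g : E -> F) x :
  (\forall y \near x, f y = g y) -> differentiable f x ->
  differentiable g x /\ 'd g x = 'd f x :> (E -> F).
Proof.
move=> fg df; have fgx : f x = g x by exact: nbhs_singleton fg.
suff H : continuous ('d f x) /\
         g \o shift x = cst (g x) + 'd f x +o_ 0 id.
  have e : 'd g x = 'd f x :> (E -> F) by apply: diff_unique; case: H.
  split=> //; apply/diff_locallyP; split; first by rewrite e; case: H.
  by rewrite e; case: H.
have /diff_locallyP [cf ef] := df.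
split=> //; apply/eqaddoP => _/posnumP[eps].
move/eqaddoP: ef => /(_ _ (gt0 eps)) ef.
have fg0 : \forall y \near (0 : E), f (y + x) = g (y + x).
  by move: fg; rewrite (near_shift 0 x) subr0.
near=> y.
have -> : (g \o shift x - (cst (g x) + 'd f x)) y =
          (f \o shift x - (cst (f x) + 'd f x)) y.
  rewrite /= !fctE /= fgx; congr (_ - _).
  by symmetry; near: y.
by near: y.
Unshelve. all: by end_near. Qed.

Lemma Ck_ext E F k (f g : E -> F) x :
  (\forall y \near x, f y = g y) -> Ck k f x -> Ck k g x.
Proof.
elim: k f g x => [|k IH] f g x fg /=.
  move=> cf; rewrite /prop_for /continuous_at -(nbhs_singleton fg).
  by apply: cvg_trans cf; apply: near_eq_cvg.
move=> [df cf]; split.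
  near=> y.
  have fgy : \forall z \near y, f z = g z by near: y; apply: nbhs_interior.
  have dfy : differentiable f y by near: y.
  by case: (near_eq_diffP fgy dfy).
move=> v; apply: IH (cf v); near=> y.
have fgy : \forall z \near y, f z = g z by near: y; apply: nbhs_interior.
have dfy : differentiable f y by near: y.
by case: (near_eq_diffP fgy dfy) => _ ->.
Unshelve. all: by end_near. Qed.

Lemma Ck_cst E F k (c : F) (x : E) : Ck k (fun=> c) x.
Proof.
elim: k c x => [|k IH] c x /=; first exact: cst_continuous.
split; first by near=> y; exact: differentiable_cst.
move=> v; apply: Ck_ext (IH 0 x); near=> y.
by rewrite (diff_cst c y).
Unshelve. all: by end_near. Qed.

Lemma Ck_id E k (x : E) : Ck k (fun y : E => y) x.
Proof.
case: k => [|k] /=; first exact: cvg_id.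
split; first by near=> y; exact: ex_diff.
move=> v; apply: Ck_ext (Ck_cst k v x); near=> y.
by rewrite diff_val.
Unshelve. all: by end_near. Qed.

Lemma diff_prod_map E E' F F' (f : E -> F) (g : E' -> F') (z : E * E') :
  differentiable f z.1 -> differentiable g z.2 ->
  differentiable (fun z : E * E' => (f z.1, g z.2)) z /\
  (forall v, 'd (fun z : E * E' => (f z.1, g z.2)) z v =
             ('d f (z.1) v.1, 'd g (z.2) v.2)).
Proof.
move=> df dg.
have l1 : linear (fun z : E * E' => z.1) by [].
have l2 : linear (fun z : E * E' => z.2) by [].
pose p1 : {linear (E * E')%type -> E} := HB.pack (fun z : E * E' => z.1)
  (GRing.isLinear.Build _ _ _ _ _ l1).
pose p2 : {linear (E * E')%type -> E'} := HB.pack (fun z : E * E' => z.2)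
  (GRing.isLinear.Build _ _ _ _ _ l2).
have c1 : continuous p1 by move=> y; exact: cvg_fst.
have c2 : continuous p2 by move=> y; exact: cvg_snd.
have d1 := linear_differentiable z c1.
have d2 := linear_differentiable z c2.
have D1 : differentiable (f \o p1) z by exact: differentiable_comp.
have D2 : differentiable (g \o p2) z by exact: differentiable_comp.
split; first exact: (differentiable_pair D1 D2).
move=> v; have -> := diff_pair D1 D2.
have e1 : 'd (f \o p1) z v = 'd f (z.1) v.1.
  by rewrite (diff_comp d1 df) /= (diff_lin z c1).
have e2 : 'd (g \o p2) z v = 'd g (z.2) v.2.
  by rewrite (diff_comp d2 dg) /= (diff_lin z c2).
by congr pair.
Qed.

Lemma Ck_prod_map E E' F F' k (f : E -> F) (g : E' -> F') (z : E * E') :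
  Ck k f z.1 -> Ck k g z.2 -> Ck k (fun z : E * E' => (f z.1, g z.2)) z.
Proof.
elim: k f g z => [|k IH] f g z /=.
  move=> cf cg.
  have c1 : fst @ z --> z.1 by exact: cvg_fst.
  have c2 : snd @ z --> z.2 by exact: cvg_snd.
  have H1 : (f \o fst) @ z --> f z.1 by exact: cvg_comp c1 cf.
  have H2 : (g \o snd) @ z --> g z.2 by exact: cvg_comp c2 cg.
  exact: cvg_pair H1 H2.
move=> [df cf] [dg cg].
have df' : \forall y \near z, differentiable f y.1.
  by have /(_ _ df) : fst @ z --> z.1 by exact: cvg_fst.
have dg' : \forall y \near z, differentiable g y.2.
  by have /(_ _ dg) : snd @ z --> z.2 by exact: cvg_snd.
split.
  by near=> y; case: (@diff_prod_map _ _ _ _ f g y) => //; near: y.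
move=> v; apply: Ck_ext (IH _ _ z (cf v.1) (cg v.2)); near=> y.
by case: (@diff_prod_map _ _ _ _ f g y) => [||_ ->] //; near: y.
Unshelve. all: by end_near. Qed.

End SmoothLemmas.

(* [chart_bwd] is only meaningful on the open set [fwd @` chart_dom]. *)
Record chart (R : realType) (E : normedModType R) (M : topologicalType) :=
  Chart {
    chart_dom : set M;
    chart_fwd :> M -> E;
    chart_bwd : E -> M;
    chart_dom_open : open chart_dom;
    chart_cod_open : open (chart_fwd @` chart_dom);
    chart_fwdK : {in chart_dom, cancel chart_fwd chart_bwd};
    chart_fwd_continuous : {in chart_dom, continuous chart_fwd};
    chart_bwd_continuous :
      {in chart_fwd @` chart_dom, continuous chart_bwd} }.

(* A smooth structure given by an atlas indexed by the points, the chart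
   [chart_at p] being defined at p. Any smooth atlas yields one. The tangent
   space at p is represented by the model space E, a tangent vector being
   identified with its coordinates in [chart_at p]. *)
HB.mixin Record Topological_isManifold (R : realType) (E : normedModType R) M
    of Topological M := {
  chart_at : M -> chart E M;
  chart_at_dom : forall p, chart_dom (chart_at p) p;
  chart_at_compat : forall p q,
    smooth_on (chart_at p @` (chart_dom (chart_at p) `&` chart_dom (chart_at q)))
              (chart_at q \o chart_bwd (chart_at p)) }.

#[short(type="manifoldType")]
HB.structure Definition Manifold (R : realType) (E : normedModType R) :=
  {M of Topological M & Topological_isManifold R E M}.

Section RowVectorManifold.
Context {R : realType} {n : nat}.

Let E : normedModType R := 'rV[R]_n.

Lemma id_chart_open : open ((fun x : E => x) @` [set: E]).
Proof. by rewrite image_id; exact: openT. Qed.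

Definition id_chart : chart E E :=
  @Chart R E E setT (fun x => x) (fun x => x) openT id_chart_open
    (fun x _ => erefl) (fun x _ => @cvg_id _ _) (fun x _ => @cvg_id _ _).

Lemma id_chart_compat (p q : 'rV[R]_n) :
  smooth_on (id_chart @` (chart_dom id_chart `&` chart_dom id_chart))
            (id_chart \o chart_bwd id_chart).
Proof. by move=> x _ k; exact: Ck_id. Qed.

HB.instance Definition _ := @Topological_isManifold.Build R E 'rV[R]_n
  (fun=> id_chart) (fun=> I) id_chart_compat.

End RowVectorManifold.

Section ProductManifold.
Context {R : realType} {E F : normedModType R}.

Section ProductChart.
Context {M N : topologicalType} (c : chart E M) (d : chart F N).

Definition prod_fwd (z : M * N) : E * F := (c z.1, d z.2).
Definition prod_bwd (y : E * F) : M * N := (chart_bwd c y.1, chart_bwd d y.2).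

Lemma image_prod_fwd (A : set M) (B : set N) :
  prod_fwd @` (A `*` B) = (c @` A) `*` (d @` B).
Proof.
apply/seteqP; split=> [_ [[x y] [/= Ax By] <-]|[u v] [/= [x Ax <-] [y By <-]]].
  by split; [exists x|exists y].
by exists (x, y).
Qed.

Lemma prod_dom_open : open (chart_dom c `*` chart_dom d).
Proof.
rewrite openE => -[x y] [/= cx dy]; exists (chart_dom c, chart_dom d) => //.
by split; apply: open_nbhs_nbhs; split=> //; exact: chart_dom_open.
Qed.

Lemma prod_cod_open : open (prod_fwd @` (chart_dom c `*` chart_dom d)).
Proof.
rewrite image_prod_fwd openE => -[x y] [/= cx dy].
exists (c @` chart_dom c, d @` chart_dom d) => //.
by split; apply: open_nbhs_nbhs; split=> //; exact: chart_cod_open.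
Qed.

Lemma prod_fwdK : {in chart_dom c `*` chart_dom d, cancel prod_fwd prod_bwd}.
Proof.
move=> [x y]; rewrite inE => -[/= cx dy].
by rewrite /prod_bwd /= !chart_fwdK ?inE.
Qed.

Lemma prod_fwd_continuous :
  {in chart_dom c `*` chart_dom d, continuous prod_fwd}.
Proof.
move=> z; rewrite inE => -[cx dy].
have c1 : fst @ z --> z.1 by exact: cvg_fst.
have c2 : snd @ z --> z.2 by exact: cvg_snd.
have cx' : z.1 \in chart_dom c by rewrite inE.
have dy' : z.2 \in chart_dom d by rewrite inE.
have H1 : (c \o fst) @ z --> c z.1.
  exact: cvg_comp c1 (chart_fwd_continuous cx').
have H2 : (d \o snd) @ z --> d z.2.
  exact: cvg_comp c2 (chart_fwd_continuous dy').
exact: cvg_pair H1 H2.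
Qed.

Lemma prod_bwd_continuous :
  {in prod_fwd @` (chart_dom c `*` chart_dom d), continuous prod_bwd}.
Proof.
move=> z; rewrite inE image_prod_fwd => -[cx dy].
have c1 : fst @ z --> z.1 by exact: cvg_fst.
have c2 : snd @ z --> z.2 by exact: cvg_snd.
have cx' : z.1 \in c @` chart_dom c by rewrite inE.
have dy' : z.2 \in d @` chart_dom d by rewrite inE.
have H1 : (chart_bwd c \o fst) @ z --> chart_bwd c z.1.
  exact: cvg_comp c1 (chart_bwd_continuous cx').
have H2 : (chart_bwd d \o snd) @ z --> chart_bwd d z.2.
  exact: cvg_comp c2 (chart_bwd_continuous dy').
exact: cvg_pair H1 H2.
Qed.

Definition prod_chart : chart (E * F)%type (M * N)%type :=
  Chart prod_dom_open prod_cod_open prod_fwdK prod_fwd_continuous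
        prod_bwd_continuous.

End ProductChart.

Context {M : manifoldType E} {N : manifoldType F}.

Let prod_chart_at (p : M * N) : chart (E * F)%type (M * N)%type :=
  prod_chart (chart_at p.1) (chart_at p.2).

Lemma prod_chart_at_dom p : chart_dom (prod_chart_at p) p.
Proof. by split; exact: chart_at_dom. Qed.

Lemma prod_chart_at_compat p q :
  smooth_on (prod_chart_at p @`
               (chart_dom (prod_chart_at p) `&` chart_dom (prod_chart_at q)))
            (prod_chart_at q \o chart_bwd (prod_chart_at p)).
Proof.
move=> _ [[x y] [[/= px py] [/= qx qy]] <-] k.
by apply: (@Ck_prod_map _ _ _ _ _ k
    (chart_at q.1 \o chart_bwd (chart_at p.1))
    (chart_at q.2 \o chart_bwd (chart_at p.2)) (_, _));
  apply: chart_at_compat; [exists x|exists y].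
Qed.

HB.instance Definition _ :=
  @Topological_isManifold.Build R (E * F)%type (M * N)%type
    prod_chart_at prod_chart_at_dom prod_chart_at_compat.

End ProductManifold.

Section SmoothMaps.
Context {R : realType} {E F : normedModType R}.
Context {M : manifoldType E} {N : manifoldType F}.

Definition smooth_map (f : M -> N) : Prop :=
  continuous f /\
  forall p q,
    smooth_on (chart_at p @`
                (chart_dom (chart_at p) `&` f @^-1` chart_dom (chart_at q)))
              (chart_at q \o f \o chart_bwd (chart_at p)).

(* T_p f : T_p M -> T_(f p) N *)
Definition tangent (f : M -> N) (p : M) : E -> F :=
  'd (chart_at (f p) \o f \o chart_bwd (chart_at p)) (chart_at p p).

End SmoothMaps.

Section FieldsAndForms.
Context {R : realType} {E : normedModType R} {M : manifoldType E}.

(* c'(t) = v in T_(c t) M *)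
Definition has_velocity (c : R -> M) (t : R) (v : E) : Prop :=
  {for t, continuous c} /\
  is_derive (t : R^o) (1 : R^o) (chart_at (c t) \o c : R^o -> E) v.

Definition velocity (c : R -> M) (t : R) : E :=
  'D_1 (chart_at (c t) \o c : R^o -> E) (t : R^o).

(* From coordinates in [chart_at p] to coordinates in [chart_at q], for
   vectors tangent to M at x. *)
Definition coord_change (p q x : M) : E -> E :=
  'd (chart_at q \o chart_bwd (chart_at p)) (chart_at p x).

(* The expression in [chart_at q] of a vector field. *)
Definition field_in_chart (q : M) (X : M -> E) (y : E) : E :=
  let x := chart_bwd (chart_at q) y in coord_change x q x (X x).

Definition smooth_field_on (W : set M) (X : M -> E) : Prop :=
  forall q, smooth_on (chart_at q @` (chart_dom (chart_at q) `&` W))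
                      (field_in_chart q X).

(* [X, Y] = XY - YX as derivations. *)
Definition field_bracket (X Y : M -> E) (p : M) : E :=
  'd (field_in_chart p Y) (chart_at p p) (X p) -
  'd (field_in_chart p X) (chart_at p p) (Y p).

Definition smooth_form (V : normedModType R) (alpha : M -> E -> V) : Prop :=
  (forall p, linear (alpha p)) /\
  forall q v,
    smooth_on (chart_at q @` chart_dom (chart_at q))
              (fun y => let x := chart_bwd (chart_at q) y in
                        alpha x (coord_change q x x v)).

Definition is_subspace (S : set E) : Prop :=
  S 0 /\ forall (a : R) u v, S u -> S v -> S (a *: u + v).

Definition lincomb (k : nat) (b : 'I_k -> E) (a : 'rV[R]_k) : E :=
  \sum_(i < k) a ord0 i *: b i.

(* Subspaces of the tangent spaces, with smooth local frames. *)
Definition smooth_distribution (H : M -> set E) : Prop :=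
  (forall p, is_subspace (H p)) /\
  forall p, exists (k : nat) (W : set M) (X : 'I_k -> M -> E),
    [/\ open W, W p, forall i, smooth_field_on W (X i) &
        forall x, W x -> injective (lincomb (X^~ x)) /\
                         range (lincomb (X^~ x)) = H x].

End FieldsAndForms.

Definition pullback (R : realType) (E F V : normedModType R)
    (M : manifoldType E) (N : manifoldType F) (f : M -> N)
    (alpha : N -> F -> V) (p : M) (v : E) : V :=
  alpha (f p) (tangent f p v).

HB.mixin Record Manifold_isLieGroup (R : realType) (n : nat) G
    of Manifold R 'rV[R]_n G & Group G := {
  lie_hausdorff : hausdorff_space G;
  lie_second_countable : @second_countable G;
  lie_mul_smooth : smooth_map (fun z : G * G => (z.1 * z.2)%g);
  lie_inv_smooth : smooth_map (fun x : G => (x^-1)%g) }.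

#[short(type="lieGroupType")]
HB.structure Definition LieGroup (R : realType) (n : nat) :=
  {G of Manifold R 'rV[R]_n G & Group G & Manifold_isLieGroup R n G}.

(* The Lie algebra T_1 G is 'rV[R]_n, through [chart_at 1]. *)
Section LieGroupTheory.
Context {R : realType} {n : nat} {G : lieGroupType R n}.
Local Notation g := 'rV[R]_n.

Definition Lmul (a : G) : G -> G := fun h => (a * h)%g.
Definition Rmul (a : G) : G -> G := fun h => (h * a)%g.

Definition left_invariant (xi : g) (a : G) : g := tangent (Lmul a) 1%g xi.

Definition lie_bracket (xi eta : g) : g :=
  field_bracket (left_invariant xi) (left_invariant eta) (1%g : G).

Definition Ad (a : G) : g -> g := tangent (Lmul a \o Rmul (a^-1)%g) 1%g.

(* t |-> exp (t xi) is the integral curve starting at 1 of the left-invariant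
   vector field of xi; this determines exp. The default value of [xget] is not
   reached, such a map existing by completeness of left-invariant fields. *)
Definition is_lie_exp (e : g -> G) : Prop :=
  e 0 = 1%g /\
  forall xi t, has_velocity (fun s : R => e (s *: xi)) t
                            (left_invariant xi (e (t *: xi))).

Definition lie_exp : g -> G := xget (fun=> 1%g) [set e | is_lie_exp e].

End LieGroupTheory.

Arguments lie_bracket {R n} G xi eta.

Section Connections.
Context {R : realType} {n : nat} {G : lieGroupType R n}.
Context {E F : normedModType R} {B : manifoldType E} {P : manifoldType F}.
Context (proj : P -> B) (act : P -> G -> P).
Local Notation g := 'rV[R]_n.

(* The tangent space of the fibre through p, as the kernel of T_p proj. *)
Definition vertical (p : P) : set F := [set w | tangent proj p w = 0].

Definition is_connection (H : P -> set F) : Prop :=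
  [/\ smooth_distribution H,
      forall p, H p `&` vertical p = [set 0],
      forall p, [set w1 + w2 | w1 in H p & w2 in vertical p] = setT &
      forall p a, H (act p a) = tangent (act^~ a) p @` H p].

Definition fundamental_field (xi : g) (p : P) : F :=
  velocity (fun t => act p (lie_exp (t *: xi))) 0.

Definition is_connection_form (H : P -> set F) (alpha : P -> F -> g) : Prop :=
  [/\ smooth_form alpha,
      forall p, H p = [set w | alpha p w = 0],
      forall xi p, alpha p (fundamental_field xi p) = xi &
      forall a p w, pullback (act^~ a) alpha p w = Ad (a^-1)%g (alpha p w)].

End Connections.

Section LocalForms.
Context {R : realType} {n : nat} (G : lieGroupType R n).
Local Notation g := 'rV[R]_n.

(* d omega, without a factor 1/2, of a g-valued 1-form on the vector space g, evaluated on
   constant vector fields. *)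
Definition ext_deriv (omega : g -> g -> g) (x xi eta : g) : g :=
  'd (omega^~ eta) x xi - 'd (omega^~ xi) x eta.

Definition form_bracket (omega : g -> g -> g) (x xi eta : g) : g :=
  lie_bracket G (omega x xi) (omega x eta) -
  lie_bracket G (omega x eta) (omega x xi).

Definition curvature (omega : g -> g -> g) (x xi eta : g) : g :=
  ext_deriv omega x xi eta + 2^-1 *: form_bracket omega x xi eta.

End LocalForms.

Section NaturalConnection.
Context {R : realType} {n : nat} (G : lieGroupType R n).
Local Notation g := 'rV[R]_n.
Local Notation P := (g * G)%type.

Definition bundle_proj (p : P) : g := p.1.
Definition bundle_act (p : P) (a : G) : P := (p.1, (p.2 * a)%g).
Definition id_section (x : g) : P := (x, 1%g).

(* By construction of the product atlas, T_(x, h) P is g * T_h G. *)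
Definition natural_horizontal (p : P) : set (g * g) :=
  [set (v, tangent (Rmul p.2) 1%g v) | v in [set: g]].

End NaturalConnection.

Arguments bundle_proj {R n} G p.
Arguments bundle_act {R n} G p a.
Arguments id_section {R n} G x.
Arguments natural_horizontal {R n} G p.

(* Main.v *)
Require Import Defs.
From HB Require Import structures.
From mathcomp Require Import all_boot all_order all_algebra.
From mathcomp Require Import all_classical all_reals all_analysis.
From mathcomp Require Import lra.

Set Implicit Arguments.
Unset Strict Implicit.
Unset Printing Implicit Defensive.

Import Order.TTheory GRing.Theory Num.Theory.
Import numFieldNormedType.Exports.

Local Open Scope classical_set_scope.
Local Open Scope ring_scope.

(** The connection form is alpha_(x, h) (v, w) = theta_h (w - T_1 R_h v), where
    theta is the Maurer-Cartan form theta_h = T_h L_(h^-1); it kills exactly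
    the vectors (v, T_1 R_h v), and it is equivariant because left and right
    translations commute.  Conversely, for any connection form alpha, the vector
    (v, v) is horizontal at (x, 1) and (0, v) is the fundamental vector of v
    there, so that alpha (v, 0) = - v.  Hence the local connection form is
    constantly - id, its exterior derivative vanishes, and
    1/2 ([- xi, - eta] - [- eta, - xi]) = [xi, eta].

    Fundamental fields are defined through exp, so the existence of exp has to be
    proved: the Picard iteration gives an integral curve of a left-invariant
    field on some ]-d, d[, whose left translates are glued together on R. *)

(** * Calculus of C^k maps *)

(** A tangent vector is stored as its coordinates in the chart attached to its own base point, so
    the coordinates of a smooth field or form may jump from point to point. Regularity is therefore
    always read in fixed charts, with [coord_change] passing between the two kinds of coordinates.
    The smoothness of the invariant fields and of theta has one source: each is a partial derivative
    of the multiplication, which is smooth in both variables jointly. For theta the multiplication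
    is differentiated at the moving point (h^-1, h), which calls for composition of C^k maps. Since
    [Ck] speaks of derivatives in constant directions only, while the chain rule produces moving
    directions, these are expanded on a finite basis. In the gluing, two consecutive translates of
    the local curve share their value at the breakpoint; being driven by the same field, they share
    their velocity there as well, and this makes the glued curve differentiable. *)

Section CkCalculus.
Context {R : realType}.
Implicit Types E F H : normedModType R.

Lemma CkS_differentiable E F k (f : E -> F) x :
  Ck k.+1 f x -> differentiable f x.
Proof. by move=> [/nbhs_singleton]. Qed.

Lemma Ck_pred E F k (f : E -> F) x : Ck k.+1 f x -> Ck k f x.
Proof.
elim: k f x => [|k IH] f x.
  by move/CkS_differentiable/differentiable_continuous.
by move=> [df cf]; split=> // v; apply: IH; exact: cf.
Qed.

Lemma Ck_continuous E F k (f : E -> F) x : Ck k f x -> {for x, continuous f}.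
Proof.
by elim: k f x => [//|k IH] f x /CkS_differentiable/differentiable_continuous.
Qed.

Lemma diff_affine E F (L : {linear E -> F}) (c : F) x : continuous L ->
  differentiable (fun y => L y + c) x /\
  forall v, 'd (fun y => L y + c) x v = L v.
Proof.
move=> cL; have dL := linear_differentiable x cL.
have dc := @differentiable_cst _ _ _ c x.
split; first exact: differentiableD.
by move=> v; have -> := diffD dL dc; rewrite /= (diff_lin x cL) fctE diff_cst addr0.
Qed.

(** The derivative of the composite in a constant direction [v] is the derivative of [f] in the
    constant direction [L v], again precomposed with the affine map, so the induction closes in any
    normed space. *)
Lemma Ck_affine E F H k (f : F -> H) (L : {linear E -> F}) (c : F) x :
  continuous L -> Ck k f (L x + c) -> Ck k (fun y => f (L y + c)) x.
Proof.
move=> cL.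
have cA y : {for y, continuous (fun y => L y + c)}.
  by apply: cvgD; [exact: cL|exact: cvg_cst].
elim: k f => [|k IH] f /=.
  by move=> cf; apply: (@continuous_comp _ _ _ (fun y => L y + c) f).
move=> [df cf].
have df' : \forall y \near x, differentiable f (L y + c) by exact: cA df.
split.
  near=> y; apply: (@differentiable_comp _ _ _ _ (fun y => L y + c) f).
    by case: (diff_affine c y cL).
  by near: y.
move=> v; apply: Ck_ext (IH _ (cf (L v))); near=> y.
have dfy : differentiable f (L y + c) by near: y.
have [dA vA] := diff_affine c y cL.
by rewrite (@diff_comp _ _ _ _ (fun y => L y + c) f y dA dfy) /= vA.
Unshelve. all: by end_near. Qed.

Lemma Ck_lin E F H k (f : E -> F) (L : {linear F -> H}) x :
  continuous L -> Ck k f x -> Ck k (fun y => L (f y)) x.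
Proof.
move=> cL; elim: k f => [|k IH] f /=.
  by move=> cf; apply: (@continuous_comp _ _ _ f L) => //; exact: cL.
move=> [df cf]; split.
  near=> y; apply: (@differentiable_comp _ _ _ _ f L); last first.
    exact: linear_differentiable.
  by near: y.
move=> v; apply: Ck_ext (IH _ (cf v)); near=> y.
have dfy : differentiable f y by near: y.
by rewrite (@diff_comp _ _ _ _ f L) ?(diff_lin _ cL) //;
  exact: linear_differentiable.
Unshelve. all: by end_near. Qed.

Lemma Ck_add E F k (f g : E -> F) x :
  Ck k f x -> Ck k g x -> Ck k (fun y => f y + g y) x.
Proof.
elim: k f g => [|k IH] f g /=; first exact: cvgD.
move=> [df cf] [dg cg]; split.
  by near=> y; apply: differentiableD; near: y.
move=> v; apply: Ck_ext (IH _ _ (cf v) (cg v)); near=> y.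
by rewrite diffD //; near: y.
Unshelve. all: by end_near. Qed.

Lemma Ck_opp E F k (f : E -> F) x : Ck k f x -> Ck k (fun y => - f y) x.
Proof.
elim: k f => [|k IH] f /=; first exact: cvgN.
move=> [df cf]; split.
  by near=> y; apply: differentiableN; near: y.
move=> v; apply: Ck_ext (IH _ (cf v)); near=> y.
by rewrite diffN //; near: y.
Unshelve. all: by end_near. Qed.

Lemma Ck_sub E F k (f g : E -> F) x :
  Ck k f x -> Ck k g x -> Ck k (fun y => f y - g y) x.
Proof. by move=> cf cg; apply: Ck_add => //; exact: Ck_opp. Qed.

Lemma Ck_sum E F k (I : Type) (r : seq I) (f : I -> E -> F) x :
  (forall i, Ck k (f i) x) -> Ck k (fun y => \sum_(i <- r) f i y) x.
Proof.
move=> cf; elim: r => [|i r IH].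
  have := Ck_cst k (0 : F) x; apply: Ck_ext; near=> y; by rewrite big_nil.
have := Ck_add (cf i) IH; apply: Ck_ext; near=> y; by rewrite big_cons.
Unshelve. all: by end_near. Qed.

(** Leibniz rule, obtained from the derivative of a continuous bilinear map along the pair
    [(f, g)]. *)
Lemma diff_scale E F (f : E -> R^o) (g : E -> F) x :
  differentiable f x -> differentiable g x ->
  differentiable (fun y => f y *: g y) x /\
  forall v, 'd (fun y => f y *: g y) x v = 'd f x v *: g x + f x *: 'd g x v.
Proof.
move=> df dg.
have dfg := differentiable_pair df dg.
pose B (a : R^o) (b : F) := a *: b.
have lB : bilinear_for (GRing.Scale.Law.clone _ _ ( *:%R ) _)
    (GRing.Scale.Law.clone _ _ ( *:%R ) _) (B : R^o -> F -> F).
  split=> [u'|u] a x' y'; rewrite /B /=.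
  - by rewrite scalerDl scalerA.
  - by rewrite scalerDr !scalerA mulrC.
pose BB : {bilinear R^o -> F -> F} := HB.pack B
  (bilinear_isBilinear.Build _ _ _ _ _ _ B lB).
have cB : continuous (fun p => BB p.1 p.2).
  move=> p; have c1 : fst @ p --> p.1 by exact: cvg_fst.
  have c2 : snd @ p --> p.2 by exact: cvg_snd.
  exact: cvgZ c1 c2.
have dB := @differentiable_bilin _ _ _ _ BB (f x, g x) cB.
have e : (fun y => f y *: g y) = (fun p => BB p.1 p.2) \o (fun y => (f y, g y)).
  by [].
rewrite e; split; first exact: differentiable_comp.
move=> v; rewrite (diff_comp dfg dB) /= (diff_bilin _ cB) /=.
have -> := diff_pair df dg.
by rewrite /= addrC.
Qed.

Lemma Ck_scale E F k (f : E -> R^o) (g : E -> F) x :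
  Ck k f x -> Ck k g x -> Ck k (fun y => f y *: g y) x.
Proof.
elim: k f g => [|k IH] f g; first by move=> cf cg; exact: cvgZ cf cg.
(* The Leibniz terms contain [f] and [g] themselves, so both are also needed at order [k]. *)
move=> Cf Cg; have Cf' := Ck_pred Cf; have Cg' := Ck_pred Cg.
move: Cf Cg => [df cf] [dg cg]; split.
  near=> y; have dfy : differentiable f y by near: y.
  have dgy : differentiable g y by near: y.
  by case: (diff_scale dfy dgy).
move=> v; apply: Ck_ext (Ck_add (IH _ _ (cf v) Cg') (IH _ _ Cf' (cg v))).
near=> y; have dfy : differentiable f y by near: y.
have dgy : differentiable g y by near: y.
by case: (diff_scale dfy dgy) => _ ->.
Unshelve. all: by end_near. Qed.

End CkCalculus.

(** * Composition of C^k maps in finite dimension *)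

Section FiniteDim.
Context {R : realType}.
Implicit Types E F H : normedModType R.

(* The existence of a finite basis with continuous coordinates, which is what
   makes the pointwise notion of C^k stable under composition. *)
Definition findim F : Prop :=
  exists (I : finType) (b : I -> F) (c : I -> {linear F -> R^o}),
    (forall i, continuous (c i)) /\ forall x, x = \sum_i c i x *: b i.

Lemma Ck_comp E F H k (f : F -> H) (g : E -> F) x : findim F ->
  Ck k f (g x) -> Ck k g x -> Ck k (fun y => f (g y)) x.
Proof.
move=> [I [b [c [cc bc]]]]; elim: k f g => [|k IH] f g.
  by move=> cf cg; apply: (@continuous_comp _ _ _ g f).
move=> [df cf] Cg; have Cg' := Ck_pred Cg.
move: Cg => [dg cg].
have df' : \forall y \near x, differentiable f (g y).
  exact: (Ck_continuous Cg') df.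
split.
  by near=> y; apply: (@differentiable_comp _ _ _ _ g f); near: y.
(* The direction ['d g y v] moves with [y]; on the basis [b] it becomes a sum of C^k scalars times
   derivatives of [f] in constant directions, to which the induction hypothesis applies. *)
move=> v; have : Ck k (fun y => \sum_i c i ('d g y v) *: 'd f (g y) (b i)) x.
  apply: Ck_sum => i; apply: Ck_scale.
    by apply: Ck_lin => //; exact: cg.
  by apply: (IH (fun z : F => 'd f z (b i))) => //; exact: cf.
apply: Ck_ext; near=> y.
rewrite (@diff_comp _ _ _ _ g f y) /=; [|by near: y..].
by rewrite [in RHS](bc ('d g y v)) linear_sum; apply: eq_bigr => i _; rewrite linearZ.
Unshelve. all: by end_near. Qed.

Lemma coord_linear m (j : 'I_m) : linear (fun v : 'rV[R]_m => v ord0 j : R^o).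
Proof. by move=> a u v; rewrite !mxE. Qed.

Definition coordl m (j : 'I_m) : {linear 'rV[R]_m -> R^o} :=
  HB.pack (fun v : 'rV[R]_m => v ord0 j : R^o)
    (GRing.isLinear.Build _ _ _ _ _ (@coord_linear m j)).

Lemma findim_rV m : findim 'rV[R]_m.
Proof.
exists 'I_m, (fun i => delta_mx ord0 i), (@coordl m); split.
  by move=> i; exact: coord_continuous.
by move=> x; rewrite {1}(row_sum_delta x).
Qed.

Lemma findim_prod E F : findim E -> findim F -> findim (E * F)%type.
Proof.
move=> [I [b [c [cc bc]]]] [J [b' [c' [cc' bc']]]].
have lf (L : {linear E -> R^o}) : linear (fun z : E * F => L z.1 : R^o).
  by move=> a u v; rewrite linearP.
have ls (L : {linear F -> R^o}) : linear (fun z : E * F => L z.2 : R^o).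
  by move=> a u v; rewrite linearP.
pose cf (L : {linear E -> R^o}) : {linear (E * F)%type -> R^o} :=
  HB.pack (fun z : (E * F)%type => L z.1 : R^o)
   (GRing.isLinear.Build _ _ _ _ _ (lf L)).
pose cs (L : {linear F -> R^o}) : {linear (E * F)%type -> R^o} :=
  HB.pack (fun z : (E * F)%type => L z.2 : R^o)
   (GRing.isLinear.Build _ _ _ _ _ (ls L)).
exists (I + J)%type, (fun k => match k with inl i => (b i, 0) | inr j => (0, b' j) end),
  (fun k => match k with inl i => cf (c i) | inr j => cs (c' j) end); split.
  case=> [i|j] z.
    by apply: continuous_comp; [exact: cvg_fst|exact: cc].
  by apply: continuous_comp; [exact: cvg_snd|exact: cc'].
have sumE (K : finType) (f : K -> (E * F)%type) :
    \sum_i f i = (\sum_i (f i).1, \sum_i (f i).2).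
  by elim/big_rec3: _ => //= i u v w _ ->; case: (f i).
move=> [x y]; rewrite big_sumType /= !sumE /=.
rewrite (eq_bigr _ (fun i _ => scaler0 _ (c i x))) big1_eq.
rewrite (eq_bigr _ (fun i _ => scaler0 _ (c' i y))) big1_eq.
by rewrite -bc -bc'; congr pair; rewrite /= ?addr0 ?add0r.
Qed.

End FiniteDim.
(** * Local solutions of ordinary differential equations *)

Section RowVectors.
Context {R : realType} {n : nat}.
Implicit Types x y c : 'rV[R]_n.

Lemma rV_norm_le x (e : R) :
  0 <= e -> (forall i, `|x ord0 i| <= e) -> `|x| <= e.
Proof.
move=> e0 xe; rewrite /Num.Def.normr /= mx_normrE.
by apply: bigmax_le => // -[i j] _ /=; rewrite (ord1 i).
Qed.

Lemma coord_norm_le x i : `|x ord0 i| <= `|x|.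
Proof.
rewrite [leRHS]/Num.Def.normr /= mx_normrE.
exact: (le_bigmax _ (fun ij => `|x ij.1 ij.2|) (ord0, i)).
Qed.

End RowVectors.

Lemma lipschitz_continuous (R : realType) (E F : normedModType R) (L : R)
    (f : E -> F) :
  (forall x y, `|f x - f y| <= L * `|x - y|) -> continuous f.
Proof.
move=> fL x; apply/cvgrPdist_lt => e e0; near=> y.
(* The constant [L] may be zero or negative; [|L| + 1] can be divided by. *)
have M0 : 0 < `|L| + 1 by rewrite ltr_wpDl.
apply: le_lt_trans (fL _ _) _.
apply: (@le_lt_trans _ _ ((`|L| + 1) * `|x - y|)).
  by rewrite ler_wpM2r // (le_trans (ler_norm L)) // lerDl.
rewrite mulrC -ltr_pdivlMr //.
by near: y; apply: cvgr_dist_lt; rewrite ?divr_gt0.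
Unshelve. all: by end_near. Qed.

(** * Truncation of times and of points *)

Section Clamp.
Context {R : realType}.
Implicit Types a s t : R.

Definition clamp a t : R := Num.max (- a) (Num.min t a).

Lemma clamp_le a t : 0 <= a -> `|clamp a t| <= a.
Proof.
move=> a0; rewrite /clamp ler_norml le_max lexx ge_max /=.
by rewrite (le_trans _ a0) ?oppr_le0 //= ge_min lexx orbT.
Qed.

Lemma clamp_id a t : `|t| <= a -> clamp a t = t.
Proof.
rewrite ler_norml => /andP[ta at_]; rewrite /clamp min_l // max_r //.
Qed.

Lemma clamp_lipschitz a s t : `|clamp a s - clamp a t| <= `|s - t|.
Proof.
rewrite /clamp.
wlog st : s t / s <= t.
  move=> H; have [/H//|/ltW/H] := leP s t; by rewrite distrC (distrC s).
rewrite (ler0_norm (x := s - t)) ?subr_le0 // /Num.max /Num.min.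
by do 4?case: ifPn; rewrite -?leNgt => *; rewrite ler_norml; lra.
Qed.

Lemma clamp_continuous a : continuous (clamp a).
Proof.
apply: (@lipschitz_continuous R R^o R^o 1) => s t; rewrite mul1r.
exact: clamp_lipschitz.
Qed.

Context {n : nat}.

(* Composing with [vclamp] makes a locally Lipschitz map globally Lipschitz. *)
Definition vclamp (c : 'rV[R]_n) a (x : 'rV[R]_n) : 'rV[R]_n :=
  \row_i (c ord0 i + clamp a (x ord0 i - c ord0 i)).

Lemma vclamp_le c a x : 0 <= a -> `|vclamp c a x - c| <= a.
Proof.
move=> a0; apply: rV_norm_le => // i; rewrite !mxE addrC addKr.
exact: clamp_le.
Qed.

Lemma vclamp_id c a x : `|x - c| <= a -> vclamp c a x = x.
Proof.
move=> xc; apply/rowP => i; rewrite mxE clamp_id; first by rewrite addrC subrK.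
by apply: le_trans xc; have := coord_norm_le (x - c) i; rewrite !mxE.
Qed.

Lemma vclamp_lipschitz c a x y : `|vclamp c a x - vclamp c a y| <= `|x - y|.
Proof.
apply: rV_norm_le => // i; rewrite !mxE opprD addrACA subrr add0r.
apply: le_trans (clamp_lipschitz _ _ _) _.
rewrite opprB addrA subrK.
by have := coord_norm_le (x - y) i; rewrite !mxE.
Qed.

End Clamp.

(** * Primitives and mean value inequalities *)

Section Primitives.
Context {R : realType}.

Lemma primitive_exists (f : R -> R) : continuous f ->
  exists P : R -> R, P 0 = 0 /\
    forall t, `|t| < 1 -> is_derive t (1 : R) P (f t).
Proof.
(* The integral starts at -1, so that 0 and the negative times of interest are interior to the
   interval on which the fundamental theorem gives a two-sided derivative. *)
move=> cf; pose Q x := (\int[lebesgue_measure]_(t in [set` `[-1, x]]) f t)%R.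
exists (fun x => Q x - Q 0); split; first by rewrite subrr.
move=> t; rewrite ltr_norml => /andP[t1 t2].
have fi : lebesgue_measure.-integrable `[(-1 : R), 1] (EFin \o f).
  apply: (@continuous_compact_integrable R f); first exact: segment_compact.
  exact: continuous_subspaceT.
have [dQ Qf] := continuous_FTC1_closed t2 fi t1 (cf t).
have H : is_derive t (1 : R) Q (f t).
  by apply: (DeriveDef dQ); rewrite -Qf -derive1E.
rewrite -[f t]subr0.
exact: (@is_deriveB _ _ _ Q (cst (Q 0))).
Qed.

Lemma primitive_row_exists n (f : R -> 'rV[R]_n) : continuous f ->
  exists P : R -> 'rV[R]_n, P 0 = 0 /\
    forall t, `|t| < 1 -> is_derive t (1 : R) P (f t).
Proof.
move=> cf.
have /choice[P PP] : forall i : 'I_n, exists P : R -> R, P 0 = 0 /\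
    forall t, `|t| < 1 -> is_derive t (1 : R) P (f t ord0 i).
  move=> i; apply: primitive_exists => t.
  apply: (@continuous_comp _ _ _ f (fun x : 'rV[R]_n => x ord0 i)).
    exact: cf.
  exact: coord_continuous.
exists (fun t => \row_i P i t); split.
  by apply/rowP => i; rewrite !mxE; case: (PP i).
move=> t t1.
have dP i : is_derive t (1 : R) (P i) (f t ord0 i) by case: (PP i) => _ /(_ t t1).
have D : derivable (fun t => \row_i P i t) t 1.
  apply/derivable_mxP => i j.
  have -> : (fun x => (\row_i P i x) i j) = P j by apply/funext => x; rewrite mxE.
  exact: ex_derive.
apply: DeriveDef => //; rewrite (derive_mx D); apply/rowP => j; rewrite !mxE.
have -> : (fun x => (\row_i P i x) ord0 j) = P j by apply/funext => x; rewrite mxE.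
exact: derive_val.
Qed.

Lemma coord_is_derive n (f : R -> 'rV[R]_n) (t : R) v i :
  is_derive t (1 : R) f v -> is_derive t (1 : R) (fun s => f s ord0 i) (v ord0 i).
Proof.
move=> df; have D := @ex_derive _ _ _ _ _ _ _ df; apply: DeriveDef.
  by move/derivable_mxP: D.
by rewrite -(@derive_val _ _ _ _ _ _ _ df) (derive_mx D) mxE.
Qed.

Lemma mean_value_le (f df : R -> R) (a M s t : R) :
  (forall x, `|x| <= a -> is_derive x (1 : R) f (df x)) ->
  (forall x, `|x| <= a -> `|df x| <= M) ->
  `|s| <= a -> `|t| <= a -> `|f s - f t| <= M * `|s - t|.
Proof.
move=> fd dM.
wlog st : s t / t <= s.
  move=> H sa ta; have [ts|/ltW ts] := leP t s; first exact: H.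
  by rewrite distrC (distrC s); exact: H.
move=> sa ta.
have I x : x \in `[t, s] -> `|x| <= a.
  move: sa ta; rewrite !ler_norml in_itv /= => /andP[_ sa] /andP[ta _] /andP[tx xs].
  by rewrite (le_trans ta tx) (le_trans xs sa).
have [||c cI ->] := @MVT_segment _ f df t s st.
- by move=> x xI; apply: fd; apply: I; exact: subset_itv_oo_cc.
- apply: derivable_within_continuous => x xI.
  exact: (@ex_derive _ _ _ _ _ _ _ (fd _ (I _ xI))).
by rewrite normrM ler_wpM2r //; apply: dM; exact: I.
Qed.

(** The norm is the maximum of the absolute values of the coordinates, so the scalar inequality
    transfers with the same constant. *)
Lemma mean_value_row_le n (f df : R -> 'rV[R]_n) (a M s t : R) :
  (forall x, `|x| <= a -> is_derive x (1 : R) f (df x)) ->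
  (forall x, `|x| <= a -> `|df x| <= M) ->
  `|s| <= a -> `|t| <= a -> `|f s - f t| <= M * `|s - t|.
Proof.
move=> fd dM sa ta; apply: rV_norm_le => [|i].
  by rewrite mulr_ge0 // (le_trans _ (dM s sa)).
rewrite !mxE; apply: (@mean_value_le (fun s => f s ord0 i)
  (fun s => df s ord0 i) a) => // x xa.
  by apply: coord_is_derive; exact: fd.
by apply: le_trans (coord_norm_le _ _) (dM _ xa).
Qed.

End Primitives.

(** * Picard iteration for a globally Lipschitz field *)

Section PicardGlobal.
Context {R : realType} {n : nat}.
Local Notation V := 'rV[R]_n.

Lemma half_pow_small (C e : R) : 0 < e -> exists k : nat, C / 2 ^+ k < e.
Proof.
move=> e0; exists (Num.truncn (`|C| / e)).+1.
rewrite ltr_pdivrMr ?exprn_gt0 // mulrC -ltr_pdivrMr //.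
apply: le_lt_trans (ler_wpM2r _ (ler_norm C)) _; first by rewrite invr_ge0 ltW.
apply: lt_trans (truncnS_gt _) _.
by rewrite -natrX ltr_nat ltn_expl.
Qed.

Lemma geometric_limit (u : nat -> V) (C : R) :
  (forall k, `|u k.+1 - u k| <= C / 2 ^+ k) ->
  exists l, forall k, `|u k - l| <= 2 * C / 2 ^+ k.
Proof.
move=> uC.
have C0 : 0 <= C by apply: le_trans (normr_ge0 _) _; have := uC 0; rewrite expr0 divr1; apply.
(* Subtracting the tail makes the bound telescope: [C / 2 ^+ k] is the difference of two consecutive
   terms of [2 * C / 2 ^+ k]. *)
have um k m : `|u (m + k) - u k| <= 2 * C / 2 ^+ k - 2 * C / 2 ^+ (m + k).
  elim: m => [|m IH]; first by rewrite !subrr normr0.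
  rewrite addSn -(subrKA (u (m + k))); apply: le_trans (ler_normD _ _) _.
  apply: le_trans (lerD (uC _) IH) _.
  rewrite exprS invfM; set x := _ ^- _; set y := _ ^- _; lra.
have um' k m : (k <= m)%N -> `|u m - u k| <= 2 * C / 2 ^+ k.
  move=> km; rewrite -(subnK km); apply: le_trans (um _ _) _.
  by rewrite gerBl divr_ge0 // ?exprn_ge0 // mulr_ge0.
have cu : cvg (u @ \oo).
  apply/cauchy_cvgP/cauchy_exP => e e0.
  have [k ke] := half_pow_small (2 * C) e0; exists (u k).
  have : \forall m \near \oo, ball (u k) e (u m).
    near=> m; rewrite -ball_normE /= distrC; apply: le_lt_trans ke; apply: um'.
    by near: m; exact: nbhs_infty_ge.
  exact.
exists (lim (u @ \oo)) => k; rewrite distrC.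
have H : `|u m - u k| @[m --> \oo] --> `|lim (u @ \oo) - u k|.
  by apply: cvg_norm; apply: cvgB; [exact: cu|exact: cvg_cst].
apply: (cvgr_to_le H).
near=> m; apply: um'; near: m; exact: nbhs_infty_ge.
Unshelve. all: by end_near. Qed.

(* A primitive on ]-1, 1[ only, hence the clamped time in [picard]. *)
Definition primitive (f : R -> V) : R -> V :=
  xget (cst 0) [set P | P 0 = 0 /\
    forall t, `|t| < 1 -> is_derive t (1 : R) P (f t)].

Lemma primitiveP f : continuous f -> primitive f 0 = 0 /\
  forall t, `|t| < 1 -> is_derive t (1 : R) (primitive f) (f t).
Proof.
move=> cf; have [P HP] := primitive_row_exists cf.
exact: (@xgetPex _ (cst 0) [set P | P 0 = 0 /\
    forall t, `|t| < 1 -> is_derive t (1 : R) P (f t)] (ex_intro _ P HP)).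
Qed.

Variables (F : V -> V) (L : R) (y0 : V).
Hypothesis L0 : 0 <= L.
Hypothesis FL : forall x y, `|F x - F y| <= L * `|x - y|.

(** Time radius: [L * a <= 1/2] makes the Picard map halve distances, and [a < 1] stays where
    [primitive] is differentiable. The summand 1 keeps the denominator positive when [L] is 0. *)
Let a := (2 * (L + 1))^-1.

Let a_gt0 : 0 < a.
Proof. by rewrite invr_gt0 mulr_gt0 // ltr_wpDl. Qed.

Let a_lt1 : a < 1.
Proof. by rewrite invf_lt1; move: L0 => ?; lra. Qed.

Let aL : L * a <= 2^-1.
Proof. by rewrite ler_pdivrMr; move: L0 => ?; lra. Qed.

Let F_continuous : continuous F.
Proof. exact: lipschitz_continuous FL. Qed.

Definition picard (z : R -> V) (t : R) : V :=
  y0 + primitive (fun s => F (z s)) (clamp a t).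

Let clamp_lt1 t : `|clamp a t| < 1.
Proof. exact: le_lt_trans (clamp_le _ (ltW a_gt0)) a_lt1. Qed.

Let Fz_continuous (z : R -> V) : continuous z -> continuous (fun s => F (z s)).
Proof.
by move=> cz t; apply: (@continuous_comp _ _ _ z F); [exact: cz|exact: F_continuous].
Qed.

Lemma picard_continuous z : continuous z -> continuous (picard z).
Proof.
move=> cz t; apply: cvgD; first exact: cvg_cst.
apply: (@continuous_comp _ _ _ (clamp a)); first exact: clamp_continuous.
have [_ /(_ _ (clamp_lt1 t)) dP] := primitiveP (Fz_continuous cz).
by apply: differentiable_continuous; apply/derivable1_diffP; exact: ex_derive.
Qed.

(** The difference of the two primitives vanishes at 0 and has derivative at most [L * d]; over a
    clamped time of size at most [a] it grows to at most [L * d * a]. *)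
Lemma picard_contract z w d : continuous z -> continuous w ->
  (forall t, `|z t - w t| <= d) ->
  forall t, `|picard z t - picard w t| <= d / 2.
Proof.
move=> cz cw zw t; rewrite /picard opprD addrACA subrr add0r.
have [z0 dz] := primitiveP (Fz_continuous cz).
have [w0 dw] := primitiveP (Fz_continuous cw).
have := @mean_value_row_le _ _
  (fun t => primitive (fun s => F (z s)) t - primitive (fun s => F (w s)) t)
  (fun t => F (z t) - F (w t)) a (L * d) (clamp a t) 0.
have la := clamp_le t (ltW a_gt0).
rewrite z0 w0 !subr0; move=> /(_ _ _ la); rewrite normr0 => H.
apply: le_trans (H _ _ (ltW a_gt0)) _.
- move=> x xa; apply: is_deriveB.
    by apply: dz; exact: le_lt_trans xa a_lt1.
  by apply: dw; exact: le_lt_trans xa a_lt1.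
- move=> x xa; apply: le_trans (FL _ _) _; exact: ler_wpM2l.
have d0 : 0 <= d by exact: le_trans (normr_ge0 _) (zw 0).
apply: le_trans (ler_wpM2l _ la) _; first exact: mulr_ge0.
by rewrite mulrAC mulrC ler_wpM2l.
Qed.

Lemma picard_Lipschitz : exists2 y : R -> V, y 0 = y0 &
  \forall t \near 0, is_derive t (1 : R) y (F (y t)).
Proof.
pose Y k := iter k picard (cst y0).
have cY k : continuous (Y k).
  elim: k => [|k IH]; first exact: cst_continuous.
  exact: picard_continuous.
(* Size of the first step: a primitive of the constant [F y0], over a time at most [a]. *)
pose C := a * `|F y0|.
have YC k t : `|Y k.+1 t - Y k t| <= C / 2 ^+ k.
  elim: k t => [|k IH] t; last first.
    by rewrite exprSr invfM mulrA; exact: (picard_contract (cY k.+1) (cY k) IH).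
  rewrite expr0 divr1 /= /picard /= addrC addKr.
  have [z0 dz] := primitiveP (Fz_continuous (cY 0)).
  have := @mean_value_row_le _ _ (primitive (fun=> F y0)) (fun=> F y0) a
    `|F y0| (clamp a t) 0.
  rewrite z0 !subr0 normr0 => H.
  apply: le_trans (H _ _ (clamp_le t (ltW a_gt0)) (ltW a_gt0)) _ => //.
    by move=> x xa; apply: dz; exact: le_lt_trans xa a_lt1.
  by rewrite mulrC ler_wpM2r // clamp_le // ltW.
have /choice[y yY] t := geometric_limit (fun k => YC k t).
(* Uniform limit of continuous functions, by the [e / 3] argument. *)
have cy : continuous y.
  move=> t; apply/cvgrPdist_lt => e e0.
  have e3 : 0 < e / 3 by rewrite divr_gt0.
  have [k ke] := half_pow_small (2 * C) e3.
  near=> s; rewrite -(subrKA (Y k t)) -[Y k t - y s](subrKA (Y k s)).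
  apply: le_lt_trans (ler_normD _ _) _.
  apply: le_lt_trans (lerD (lexx _) (ler_normD _ _)) _.
  have h1 := yY t k; have h2 := yY s k; rewrite distrC in h1.
  have h3 : `|Y k t - Y k s| < e / 3.
    by near: s; exact: (cvgr_dist_lt _ _ (cY k t)).
  lra.
(* Both sides are within a multiple of [2 ^- k] of [Y k.+1], the left one by contraction. *)
have py : picard y = y.
  apply/funext => t; apply/eqP; rewrite -subr_eq0 -normr_le0.
  apply/ler_addgt0Pl => e e0; rewrite addr0.
  have [k ke] := half_pow_small (2 * C) e0.
  rewrite -(subrKA (Y k.+1 t)); apply: le_trans (ler_normD _ _) _.
  have h1 : `|picard y t - Y k.+1 t| <= 2 * C / 2 ^+ k / 2.
    by apply: picard_contract => // s; rewrite distrC; exact: yY.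
  have h2 := yY t k.+1; rewrite exprSr invfM mulrA in h2.
  apply: le_trans (lerD h1 h2) _; lra.
have [p0 dp] := primitiveP (Fz_continuous cy).
exists y.
  by rewrite -py /picard clamp_id ?normr0 ?ltW // p0 addr0.
near=> t.
have ta : `|t| < a.
  near: t; apply: (cvgr_norm_lt (0 : R)); [exact: cvg_id|by rewrite normr0].
have dpt : is_derive t (1 : R) (primitive (fun s => F (y s))) (F (y t)).
  by apply: dp; exact: lt_trans ta a_lt1.
have d : is_derive t (1 : R)
    (cst y0 + primitive (fun s => F (y s))) (F (y t)).
  by rewrite -[F (y t)]add0r; apply: is_deriveD.
(* Where [|s| < a] the clamp is the identity, so the fixed-point equation is the integral form of
   the differential equation. *)
apply: near_eq_is_derive d; near=> s; rewrite -[in RHS]py /picard clamp_id //.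
have : `|s| < a by near: s; apply: (cvgr_norm_lt t); [exact: cvg_id|].
exact: ltW.
Unshelve. all: by end_near. Qed.

End PicardGlobal.

(** * From Lipschitz fields to C^1 fields *)

Section PicardLocal.
Context {R : realType}.

Lemma diff_norm_le m n (f : 'rV[R]_m -> 'rV[R]_n) (z v : 'rV[R]_m) :
  `|'d f z v| <= (\sum_j `|'d f z (delta_mx ord0 j)|) * `|v|.
Proof.
rewrite {1}(row_sum_delta v) linear_sum mulr_suml.
apply: le_trans (ler_norm_sum _ _ _) _; apply: ler_sum => j _.
by rewrite linearZ normrZ mulrC ler_wpM2l // coord_norm_le.
Qed.

Lemma C1_lipschitz m n (f : 'rV[R]_m -> 'rV[R]_n) (c : 'rV[R]_m) :
  Ck 1 f c -> exists L r, [/\ 0 <= L, 0 < r &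
    forall x y, `|x - c| <= r -> `|y - c| <= r ->
      `|f x - f y| <= L * `|x - y|].
Proof.
move=> [df cf].
(* [S z] bounds the operator norm of ['d f z], and it is continuous at [c] because it involves only
   finitely many constant directions. *)
pose S z := \sum_j `|'d f z (delta_mx ord0 j)|.
have cS : {for c, continuous S}.
  apply: (@Ck_sum R 'rV[R]_m R^o 0 _ _
    (fun j z => `|'d f z (delta_mx ord0 j)|)) => j.
  have cj : {for c, continuous (fun z => 'd f z (delta_mx ord0 j))} := cf _.
  exact: (cvg_norm cj).
have S0 z : 0 <= S z by exact: sumr_ge0.
have : \forall z \near c, differentiable f z /\ S z <= S c + 1.
  near=> z; split; first by near: z.
  near: z; apply: (cvgr_le (S c)) => //; by rewrite ltrDl.
move=> /nbhs_normP[e /= e0 ec].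
(* The closed ball of radius [e / 2] lies in the open ball of radius [e] where [S] is controlled. By
   convexity it contains the segment [p] from [y] to [x], along which the mean value theorem is
   applied to each coordinate. *)
exists (S c + 1), (e / 2); split; [by rewrite addr_ge0 | by rewrite divr_gt0 |].
move=> x y xc yc.
pose p (s : R) := s *: (x - y) + y.
have pc s : `|s| <= 1 -> 0 <= s -> `|p s - c| < e.
  rewrite /p ler_norml => /andP[_ s1] s0.
  have -> : s *: (x - y) + y - c = (1 - s) *: (y - c) + s *: (x - c).
    by apply/rowP => i; rewrite !mxE; lra.
  apply: le_lt_trans (ler_normD _ _) _; rewrite !normrZ.
  rewrite ger0_norm ?subr_ge0 // ger0_norm //.
  apply: (@le_lt_trans _ _ ((1 - s) * (e / 2) + s * (e / 2))).
    by rewrite lerD // ler_wpM2l // subr_ge0.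
  by rewrite -mulrDl subrK mul1r; lra.
have E s : 0 <= s -> s <= 1 -> differentiable f (p s) /\ S (p s) <= S c + 1.
  move=> s0 s1; apply: ec; rewrite /= distrC; apply: pc => //.
  by rewrite ger0_norm.
have lL : linear (fun s : R^o => s *: (x - y)).
  by move=> k u v; rewrite scalerDl scalerA.
pose L : {linear R^o -> 'rV[R]_m} := HB.pack (fun s : R^o => s *: (x - y))
  (GRing.isLinear.Build _ _ _ _ _ lL).
have cL : continuous L by move=> s; exact: scalel_continuous.
have dp s : differentiable p s := (diff_affine y s cL).1.
have vp s : 'd p s 1 = x - y.
  by rewrite (diff_affine y s cL).2 /= scale1r.
have -> : f x = f (p 1) by rewrite /p scale1r subrK.
have -> : f y = f (p 0) by rewrite /p scale0r add0r.
apply: rV_norm_le => [|i].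
  by rewrite mulr_ge0 // addr_ge0.
rewrite !mxE.
have dfp (s : R) : 0 <= s -> s <= 1 -> is_derive s (1 : R) (f \o p) ('d f (p s) (x - y)).
  move=> s0 s1; have [dfs _] := E s s0 s1.
  have D : differentiable (f \o p) s by exact: differentiable_comp.
  apply: DeriveDef; first exact/derivable1_diffP.
  by rewrite deriveE // diff_comp //= vp.
have [||s] := @MVT_segment _ (fun s => f (p s) ord0 i)
    (fun s => 'd f (p s) (x - y) ord0 i) 0 1 ler01.
- move=> s; rewrite in_itv /= => /andP[/ltW s0 /ltW s1].
  by apply: (coord_is_derive (f := f \o p)); exact: dfp.
- apply: derivable_within_continuous => s; rewrite in_itv /= => /andP[s0 s1].
  exact: (@ex_derive _ _ _ _ _ _ _ (coord_is_derive i (dfp s s0 s1))).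
rewrite in_itv /= => /andP[s0 s1] ->; rewrite subr0 mulr1.
apply: le_trans (coord_norm_le _ _) _; apply: le_trans (diff_norm_le _ _ _) _.
by apply: ler_wpM2r => //; case: (E s s0 s1).
Unshelve. all: by end_near. Qed.

(** [vclamp] makes the field globally Lipschitz without changing it near [y0]; by continuity the
    solution stays near [y0] for small times, so it solves the original equation. *)
Lemma picard_C1 n (F : 'rV[R]_n -> 'rV[R]_n) (y0 : 'rV[R]_n) : Ck 1 F y0 ->
  exists2 y : R -> 'rV[R]_n, y 0 = y0 &
    \forall t \near 0, is_derive t (1 : R) y (F (y t)).
Proof.
move=> /C1_lipschitz[L [r [L0 r0 FL]]].
have H x y : `|F (vclamp y0 r x) - F (vclamp y0 r y)| <= L * `|x - y|.
  apply: le_trans (FL _ _ _ _) _; try exact: vclamp_le (ltW r0).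
  by rewrite ler_wpM2l // vclamp_lipschitz.
have [y y00 dy] := picard_Lipschitz y0 L0 H.
exists y => //.
have cy : {for 0, continuous y}.
  have d0 := nbhs_singleton dy.
  by apply: differentiable_continuous; apply/derivable1_diffP; exact: ex_derive.
near=> t.
have yt : `|y t - y0| <= r.
  rewrite distrC -y00; near: t; exact: (cvgr_dist_le _ _ cy).
have : is_derive t (1 : R) y (F (vclamp y0 r (y t))) by near: t.
by rewrite vclamp_id.
Unshelve. all: by end_near. Qed.

End PicardLocal.

(** * Tangent maps in charts *)

Section ManifoldCalculus.
Context {R : realType}.
Implicit Types E F H : normedModType R.

(** Used to compare expressions in a chart: every nearby coordinate vector is [chart_at p z] for
    some [z] of the domain, where [chart_bwd] inverts the chart. *)
Lemma image_chart_near E (M : manifoldType E) (p x : M) :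
  chart_dom (chart_at p) x ->
  \forall y \near chart_at p x, (chart_at p @` chart_dom (chart_at p)) y.
Proof.
move=> px; apply: open_nbhs_nbhs; split; first exact: chart_cod_open.
by exists x.
Qed.

Lemma chart_bwdK E (M : manifoldType E) (p x : M) :
  chart_dom (chart_at p) x -> chart_bwd (chart_at p) (chart_at p x) = x.
Proof. by move=> px; rewrite chart_fwdK // inE. Qed.

Lemma chart_at_bwdK E (M : manifoldType E) (p : M) :
  chart_bwd (chart_at p) (chart_at p p) = p.
Proof. exact: chart_bwdK (chart_at_dom p). Qed.

Lemma chart_bwd_cvg E (M : manifoldType E) (p x : M) :
  chart_dom (chart_at p) x -> chart_bwd (chart_at p) @ chart_at p x --> x.
Proof.
move=> px; rewrite -{2}(chart_bwdK px); apply: chart_bwd_continuous.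
by rewrite inE; exists x.
Qed.

Lemma chart_dom_near E (M : manifoldType E) (p x : M) :
  chart_dom (chart_at p) x -> \forall y \near x, chart_dom (chart_at p) y.
Proof.
by move=> px; apply: open_nbhs_nbhs; split => //; exact: chart_dom_open.
Qed.

(** Here [p] and [q] only name charts. They stay fixed while the point varies, unlike in [tangent],
    which uses the charts at the point and at its image. *)
Definition loc E F (M : manifoldType E) (N : manifoldType F) (f : M -> N)
    (p : M) (q : N) : E -> F :=
  chart_at q \o f \o chart_bwd (chart_at p).

Definition dloc E F (M : manifoldType E) (N : manifoldType F) (f : M -> N)
    (p : M) (q : N) (x : M) : E -> F := 'd (loc f p q) (chart_at p x).

Lemma smooth_loc E F (M : manifoldType E) (N : manifoldType F) (f : M -> N)
    p q x k : smooth_map f ->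
  chart_dom (chart_at p) x -> chart_dom (chart_at q) (f x) ->
  Ck k (loc f p q) (chart_at p x).
Proof. by move=> [_ sf] px qfx; apply: sf; exists x. Qed.

Lemma smooth_loc_diff E F (M : manifoldType E) (N : manifoldType F)
    (f : M -> N) p q x : smooth_map f ->
  chart_dom (chart_at p) x -> chart_dom (chart_at q) (f x) ->
  differentiable (loc f p q) (chart_at p x).
Proof.
by move=> sf px qfx; apply: (@CkS_differentiable _ _ _ 0); exact: smooth_loc.
Qed.

(** [loc idfun p q] is the transition map and [coord_change p q] its derivative, so the
    change-of-chart rules are instances of the chain rule [loc_comp]. *)
Lemma smooth_map_id E (M : manifoldType E) : smooth_map (@idfun M).
Proof.
split; first by move=> x; exact: cvg_id.
by move=> p q; exact: chart_at_compat.
Qed.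

Lemma loc_comp E F H (M : manifoldType E) (N : manifoldType F)
    (O : manifoldType H) (f : M -> N) (g : N -> O) p q r x :
  smooth_map f -> smooth_map g ->
  chart_dom (chart_at p) x -> chart_dom (chart_at q) (f x) ->
  chart_dom (chart_at r) (g (f x)) ->
  differentiable (loc (g \o f) p r) (chart_at p x) /\
  forall v, 'd (loc (g \o f) p r) (chart_at p x) v =
    'd (loc g q r) (chart_at q (f x)) ('d (loc f p q) (chart_at p x) v).
Proof.
move=> sf sg px qf rgf.
have df := smooth_loc_diff sf px qf.
have dg := smooth_loc_diff sg qf rgf.
(* The two expressions agree only where [f] stays in the domain of the intermediate chart [q]. *)
have e : \forall y \near chart_at p x,
    (loc g q r \o loc f p q) y = loc (g \o f) p r y.
  have cf : f \o chart_bwd (chart_at p) @ chart_at p x --> f x.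
    exact: cvg_comp (chart_bwd_cvg px) (sf.1 x).
  have : \forall y \near chart_at p x,
      chart_dom (chart_at q) (f (chart_bwd (chart_at p) y)).
    exact: cf _ (chart_dom_near qf).
  apply: filterS => y qy.
  by rewrite /loc /= chart_bwdK.
have fx : loc f p q (chart_at p x) = chart_at q (f x).
  by rewrite /loc /= chart_bwdK.
have dg' : differentiable (loc g q r) (loc f p q (chart_at p x)) by rewrite fx.
have dgf : differentiable (loc g q r \o loc f p q) (chart_at p x).
  exact: differentiable_comp.
have [d1 d2] := near_eq_diffP e dgf; split=> // v.
by rewrite d2 diff_comp //= fx.
Qed.

Lemma coord_change_id E (M : manifoldType E) (p x : M) v :
  chart_dom (chart_at p) x -> coord_change p p x v = v.
Proof.
move=> px.
have e : \forall y \near chart_at p x, y = (chart_at p \o chart_bwd (chart_at p)) y.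
  have := image_chart_near px; apply: filterS => _ [z pz <-] /=.
  by rewrite chart_bwdK.
have d : differentiable (fun y : E => y) (chart_at p x) by exact: ex_diff.
have [_] := near_eq_diffP e d; rewrite /coord_change => ->.
by rewrite diff_val.
Qed.

Lemma diff_loc_change E F (M : manifoldType E) (N : manifoldType F)
    (f : M -> N) p q q' x v : smooth_map f ->
  chart_dom (chart_at p) x -> chart_dom (chart_at q) (f x) ->
  chart_dom (chart_at q') (f x) ->
  coord_change q q' (f x) (dloc f p q x v) = dloc f p q' x v.
Proof.
move=> sf px qf q'f; symmetry.
exact: (loc_comp sf (@smooth_map_id F N) px qf q'f).2.
Qed.

Lemma diff_loc_change_dom E F (M : manifoldType E) (N : manifoldType F)
    (f : M -> N) p p' q x v : smooth_map f ->
  chart_dom (chart_at p) x -> chart_dom (chart_at p') x ->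
  chart_dom (chart_at q) (f x) ->
  dloc f p q x (coord_change p' p x v) = dloc f p' q x v.
Proof.
move=> sf px p'x qf; symmetry.
exact: (loc_comp (@smooth_map_id E M) sf p'x px qf).2.
Qed.

Lemma coord_change_comp E (M : manifoldType E) (p q r x : M) v :
  chart_dom (chart_at p) x -> chart_dom (chart_at q) x ->
  chart_dom (chart_at r) x ->
  coord_change q r x (coord_change p q x v) = coord_change p r x v.
Proof. exact: (diff_loc_change v (@smooth_map_id E M)). Qed.

Lemma coord_changeK E (M : manifoldType E) (p q x : M) v :
  chart_dom (chart_at p) x -> chart_dom (chart_at q) x ->
  coord_change q p x (coord_change p q x v) = v.
Proof.
by move=> px qx; rewrite (coord_change_comp v px qx px) coord_change_id.
Qed.

Lemma tangent_comp E F H (M : manifoldType E) (N : manifoldType F)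
    (O : manifoldType H) (f : M -> N) (g : N -> O) x v :
  smooth_map f -> smooth_map g ->
  tangent (g \o f) x v = tangent g (f x) (tangent f x v).
Proof.
by move=> sf sg; apply: (loc_comp sf sg _ _ _).2; exact: chart_at_dom.
Qed.

Lemma tangent_idfun E (M : manifoldType E) (x : M) v : tangent (@idfun M) x v = v.
Proof. exact/coord_change_id/chart_at_dom. Qed.

(** Charts are indexed by points, so the value of [f x] is passed as an equation: with [mulVg], for
    instance, [z^-1 * z] is read in the chart at 1. *)
Lemma tangent_coord_change E F (M : manifoldType E) (N : manifoldType F)
    (f : M -> N) p x z v : smooth_map f -> f x = z -> chart_dom (chart_at p) x ->
  tangent f x (coord_change p x x v) = dloc f p z x v.
Proof.
move=> sf <- px.
exact: (diff_loc_change_dom v sf (chart_at_dom x) px (chart_at_dom (f x))).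
Qed.

Lemma tangent_in_chart E F (M : manifoldType E) (N : manifoldType F)
    (f : M -> N) p q z v : smooth_map f -> f p = z ->
  chart_dom (chart_at q) z ->
  coord_change z q z (tangent f p v) = dloc f p q p v.
Proof.
move=> sf <- qz.
exact: (diff_loc_change v sf (chart_at_dom p) (chart_at_dom (f p)) qz).
Qed.

Lemma field_in_chartE E (M : manifoldType E) (X : M -> E) q x :
  chart_dom (chart_at q) x ->
  field_in_chart q X (chart_at q x) = coord_change x q x (X x).
Proof. by move=> qx; rewrite /field_in_chart chart_bwdK. Qed.

Lemma has_velocity_comp E F (M : manifoldType E) (N : manifoldType F)
    (f : M -> N) (c : R -> M) t v : smooth_map f ->
  has_velocity c t v -> has_velocity (f \o c) t (tangent f (c t) v).
Proof.
move=> sf [cc dc]; split.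
  by apply: continuous_comp => //; exact: sf.1.
have df := smooth_loc_diff sf (chart_at_dom (c t)) (chart_at_dom (f (c t))).
have dc' : differentiable (chart_at (c t) \o c : R^o -> E) (t : R^o).
  by apply/derivable1_diffP; exact: ex_derive.
have e1 : 'd (chart_at (c t) \o c : R^o -> E) (t : R^o) (1 : R^o) = v.
  by rewrite -deriveE // derive_val.
have D : differentiable (loc f (c t) (f (c t)) \o (chart_at (c t) \o c) : R^o -> F) (t : R^o).
  exact: differentiable_comp.
have : is_derive (t : R^o) (1 : R^o)
   (loc f (c t) (f (c t)) \o (chart_at (c t) \o c) : R^o -> F) (tangent f (c t) v).
  apply: DeriveDef; first exact/derivable1_diffP.
  by rewrite deriveE // diff_comp //= e1.
apply: near_eq_is_derive; near=> s.
rewrite /loc /= chart_bwdK //; near: s.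
exact: cc _ (chart_dom_near (chart_at_dom (c t))).
Unshelve. all: by end_near. Qed.

End ManifoldCalculus.

(** * Slices and partial derivatives of maps on products *)

Section PartialMaps.
Context {R : realType}.
Implicit Types E F H : normedModType R.

Lemma inl_linear E F : linear (fun x : E => (x, 0) : E * F).
Proof. by move=> a u v; congr pair; rewrite /= scaler0 addr0. Qed.

Lemma inr_linear E F : linear (fun x : F => (0, x) : E * F).
Proof. by move=> a u v; congr pair; rewrite /= scaler0 addr0. Qed.

Lemma diag_linear E : linear (fun x : E => (x, x)).
Proof. by []. Qed.

Lemma snd_linear E F : linear (fun z : E * F => z.2).
Proof. by []. Qed.

Definition inl_lin E F : {linear E -> (E * F)%type} := HB.pack
  (fun x : E => (x, 0) : E * F) (GRing.isLinear.Build _ _ _ _ _ (@inl_linear E F)).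

Definition inr_lin E F : {linear F -> (E * F)%type} := HB.pack
  (fun x : F => (0, x) : E * F) (GRing.isLinear.Build _ _ _ _ _ (@inr_linear E F)).

Definition diag_lin E : {linear E -> (E * E)%type} := HB.pack
  (fun x : E => (x, x)) (GRing.isLinear.Build _ _ _ _ _ (@diag_linear E)).

Definition snd_lin E F : {linear (E * F)%type -> F} := HB.pack
  (fun z : E * F => z.2) (GRing.isLinear.Build _ _ _ _ _ (@snd_linear E F)).

Lemma inl_continuous E F : continuous (@inl_lin E F).
Proof. by move=> x; apply: cvg_pair; [exact: cvg_id|exact: cvg_cst]. Qed.

Lemma inr_continuous E F : continuous (@inr_lin E F).
Proof. by move=> x; apply: cvg_pair; [exact: cvg_cst|exact: cvg_id]. Qed.

Lemma diag_continuous E : continuous (@diag_lin E).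
Proof. by move=> x; apply: cvg_pair; exact: cvg_id. Qed.

Lemma snd_lin_continuous E F : continuous (@snd_lin E F).
Proof. by move=> x; exact: cvg_snd. Qed.

Lemma inl_linD E F (x : E) (b : F) : @inl_lin E F x + (0, b) = (x, b).
Proof. by congr pair; rewrite /= ?addr0 ?add0r. Qed.

Lemma inr_linD E F (a : E) (y : F) : @inr_lin E F y + (a, 0) = (a, y).
Proof. by congr pair; rewrite /= ?addr0 ?add0r. Qed.

Lemma Ck_slicel E F H k (f : E * F -> H) a b :
  Ck k f (a, b) -> Ck k (fun x => f (x, b)) a.
Proof.
move=> cf; have := @Ck_affine _ _ _ _ k f (@inl_lin E F) (0, b) a (@inl_continuous E F).
rewrite inl_linD => /(_ cf); apply: Ck_ext; near=> x; by rewrite inl_linD.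
Unshelve. all: by end_near. Qed.

Lemma Ck_slicer E F H k (f : E * F -> H) a b :
  Ck k f (a, b) -> Ck k (fun y => f (a, y)) b.
Proof.
move=> cf; have := @Ck_affine _ _ _ _ k f (@inr_lin E F) (a, 0) b (@inr_continuous E F).
rewrite inr_linD => /(_ cf); apply: Ck_ext; near=> x; by rewrite inr_linD.
Unshelve. all: by end_near. Qed.

Lemma Ck_pair E F H k (f : E -> F) (g : E -> H) x :
  Ck k f x -> Ck k g x -> Ck k (fun y => (f y, g y)) x.
Proof.
move=> cf cg; have := @Ck_prod_map _ _ _ _ _ k f g (x, x) cf cg.
have <- : @diag_lin E x + 0 = (x, x) by rewrite addr0.
move/(Ck_affine (@diag_continuous E)); apply: Ck_ext.
by near=> y; rewrite addr0.
Unshelve. all: by end_near. Qed.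

Lemma diff_slicel E F H (f : E * F -> H) a b u : differentiable f (a, b) ->
  'd (fun x => f (x, b)) a u = 'd f (a, b) (u, 0).
Proof.
move=> df.
have d1 : differentiable (fun x : E => x) a by exact: ex_diff.
have d2 := @differentiable_cst _ E F b a.
have dp := differentiable_pair d1 d2.
have e2 : 'd (fun=> b) a u = 0 by rewrite (diff_cst b a).
rewrite (@diff_comp _ _ _ _ (fun x => (x, b)) f a dp df) /=.
by rewrite (diff_pair d1 d2) /= diff_val e2.
Qed.

Lemma diff_slicer E F H (f : E * F -> H) a b u : differentiable f (a, b) ->
  'd (fun y => f (a, y)) b u = 'd f (a, b) (0, u).
Proof.
move=> df.
have d1 : differentiable (fun x : F => x) b by exact: ex_diff.
have d2 := @differentiable_cst _ F E a b.
have dp := differentiable_pair d2 d1.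
have e2 : 'd (fun=> a) b u = 0 by rewrite (diff_cst a b).
rewrite (@diff_comp _ _ _ _ (fun x => (a, x)) f b dp df) /=.
by rewrite (diff_pair d2 d1) /= e2 diff_val.
Qed.

(** The partial derivative is the full derivative in the constant direction [(u, 0)], restricted to
    a slice. *)
Lemma Ck_partiall E F H k (f : E * F -> H) a b u : Ck k.+1 f (a, b) ->
  Ck k (fun y => 'd (fun x => f (x, y)) a u) b.
Proof.
move=> cf; have df := (Ck_continuous (Ck_slicer (Ck_pred cf))).
have := Ck_slicer (cf.2 (u, 0)); apply: Ck_ext.
have : \forall y \near b, differentiable f (a, y).
  have H0 : (fun y => (a, y)) @ b --> (a, b).
    by apply: cvg_pair; [exact: cvg_cst|exact: cvg_id].
  exact: H0 _ cf.1.
by apply: filterS => y dfy; rewrite diff_slicel.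
Qed.

Lemma Ck_partialr E F H k (f : E * F -> H) a b u : Ck k.+1 f (a, b) ->
  Ck k (fun x => 'd (fun y => f (x, y)) b u) a.
Proof.
move=> cf; have := Ck_slicel (cf.2 (0, u)); apply: Ck_ext.
have : \forall x \near a, differentiable f (x, b).
  have H0 : (fun x => (x, b)) @ a --> (a, b).
    by apply: cvg_pair; [exact: cvg_id|exact: cvg_cst].
  exact: H0 _ cf.1.
by apply: filterS => y dfy; rewrite diff_slicer.
Qed.

Lemma smooth_map_slicer E F H (M : manifoldType E) (N : manifoldType F)
    (O : manifoldType H) (f : M * N -> O) (a : M) :
  smooth_map f -> smooth_map (fun y => f (a, y)).
Proof.
move=> [cf sf]; split.
  move=> y; apply: (@continuous_comp _ _ _ (fun y => (a, y)) f); last exact: cf.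
  by apply: cvg_pair; [exact: cvg_cst|exact: cvg_id].
move=> p q _ [y [py qy] <-] k.
have : Ck k (loc f (a, p) q) (chart_at a a, chart_at p y).
  by apply: sf; exists (a, y) => //; split => //; split => //; exact: chart_at_dom.
move/Ck_slicer; apply: Ck_ext; near=> z.
by rewrite /loc /= /prod_bwd /= chart_at_bwdK.
Unshelve. all: by end_near. Qed.

Lemma smooth_map_slicel E F H (M : manifoldType E) (N : manifoldType F)
    (O : manifoldType H) (f : M * N -> O) (b : N) :
  smooth_map f -> smooth_map (fun x => f (x, b)).
Proof.
move=> [cf sf]; split.
  move=> y; apply: (@continuous_comp _ _ _ (fun y => (y, b)) f); last exact: cf.
  by apply: cvg_pair; [exact: cvg_id|exact: cvg_cst].
move=> p q _ [y [py qy] <-] k.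
have : Ck k (loc f (p, b) q) (chart_at p y, chart_at b b).
  by apply: sf; exists (y, b) => //; split => //; split => //; exact: chart_at_dom.
move/Ck_slicel; apply: Ck_ext; near=> z.
by rewrite /loc /= /prod_bwd /= chart_at_bwdK.
Unshelve. all: by end_near. Qed.

(** For the multiplication and [a = 1] this differentiates [z * y] in [z], which yields the
    right-invariant fields; the next lemma yields the left-invariant ones. *)
Lemma Ck_dloc_partiall E F H (M : manifoldType E) (N : manifoldType F)
    (O : manifoldType H) (f : M * N -> O) a p q x v k :
  smooth_map f -> chart_dom (chart_at p) x -> chart_dom (chart_at q) (f (a, x)) ->
  Ck k (fun y => dloc (fun z => f (z, chart_bwd (chart_at p) y)) a q a v)
    (chart_at p x).
Proof.
move=> sf px qf; apply: (@Ck_partiall _ _ _ _ (loc f (a, p) q)).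
apply: (@smooth_loc _ _ _ _ _ _ (a, p) q (a, x)) => //.
by split => //; exact: chart_at_dom.
Qed.

Lemma Ck_dloc_partialr E F H (M : manifoldType E) (N : manifoldType F)
    (O : manifoldType H) (f : M * N -> O) a p q x v k :
  smooth_map f -> chart_dom (chart_at p) x -> chart_dom (chart_at q) (f (x, a)) ->
  Ck k (fun y => dloc (fun z => f (chart_bwd (chart_at p) y, z)) a q a v)
    (chart_at p x).
Proof.
move=> sf px qf; apply: (@Ck_partialr _ _ _ _ (loc f (p, a) q)).
apply: (@smooth_loc _ _ _ _ _ _ (p, a) q (x, a)) => //.
by split => //; exact: chart_at_dom.
Qed.

(** The parameter [i h] and the point of differentiation [h] move together. With the multiplication
    for [f] and the inversion for [i], the map differentiated at [h] is left translation by [h^-1],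
    giving the Maurer-Cartan form. *)
Lemma Ck_dloc_diag E F H (M : manifoldType E) (N : manifoldType F)
    (O : manifoldType H) (f : M * N -> O) (i : N -> M) q r x w k :
  findim E -> findim F -> smooth_map f -> smooth_map i ->
  chart_dom (chart_at q) x -> chart_dom (chart_at r) (f (i x, x)) ->
  Ck k (fun y => let h := chart_bwd (chart_at q) y in
                 dloc (fun z => f (i h, z)) q r h w) (chart_at q x).
Proof.
move=> fE fF sf si qx rf.
(* The parameter is read in the fixed chart at [i x], so the derivative becomes
   ['d Phi (j y, y) (0, w)]: a C^k map composed with the curve-like map [(j y, y)]. *)
pose Phi := loc f (i x, q) r; pose j := loc i q (i x).
have jx : j (chart_at q x) = chart_at (i x) (i x) by rewrite /j /loc /= chart_bwdK.
have Cj k' : Ck k' j (chart_at q x) by apply: smooth_loc => //; exact: chart_at_dom.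
have CPhi : Ck k.+1 Phi (j (chart_at q x), chart_at q x).
  rewrite jx; apply: (@smooth_loc _ _ _ _ _ _ (i x, q) r (i x, x)) => //.
  by split => //; exact: chart_at_dom.
have Cpair k' : Ck k' (fun y => (j y, y)) (chart_at q x).
  by apply: Ck_pair => //; exact: Ck_id.
have := @Ck_comp _ _ _ _ k (fun z => 'd Phi z (0, w)) (fun y => (j y, y))
  (chart_at q x) (findim_prod fE fF) (CPhi.2 (0, w)) (Cpair k).
apply: Ck_ext.
have N1 : \forall y \near chart_at q x, differentiable Phi (j y, y).
  exact: (Ck_continuous (Cpair 0)) CPhi.1.
have N2 : \forall y \near chart_at q x,
    chart_dom (chart_at (i x)) (i (chart_bwd (chart_at q) y)).
  have H0 : (fun y => i (chart_bwd (chart_at q) y)) @ chart_at q x --> i x.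
    exact: cvg_comp (chart_bwd_cvg qx) (si.1 x).
  exact: H0 _ (chart_dom_near (chart_at_dom _)).
have N3 := image_chart_near qx.
near=> y.
have dPhi : differentiable Phi (j y, y) by near: y.
have dom_y : chart_dom (chart_at (i x)) (i (chart_bwd (chart_at q) y)) by near: y.
have [z qz zy] : (chart_at q @` chart_dom (chart_at q)) y by near: y.
have hy : chart_at q (chart_bwd (chart_at q) y) = y by rewrite -zy chart_bwdK.
rewrite -(diff_slicer _ dPhi) /= /dloc hy.
congr ('d _ _ _); apply/funext => u.
by rewrite /Phi /j /loc /= /prod_bwd /= chart_bwdK.
Unshelve. all: by end_near. Qed.

End PartialMaps.

(** * Invariant fields and the Maurer-Cartan form *)

Section LieGroupCalculus.
Context {R : realType} {n : nat} {G : lieGroupType R n}.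
Local Notation g := 'rV[R]_n.
Implicit Types (a b h x : G) (v w xi : g).

Lemma smooth_Lmul a : smooth_map (Lmul a).
Proof. exact: (smooth_map_slicer a (@lie_mul_smooth R n G)). Qed.

Lemma smooth_Rmul a : smooth_map (Rmul a).
Proof. exact: (smooth_map_slicel a (@lie_mul_smooth R n G)). Qed.

Lemma Lmul_comp a b : Lmul a \o Lmul b = Lmul (a * b)%g.
Proof. by apply/funext => x; rewrite /Lmul /= mulgA. Qed.

Lemma Rmul_comp a b : Rmul a \o Rmul b = Rmul (b * a)%g.
Proof. by apply/funext => x; rewrite /Rmul /= mulgA. Qed.

Lemma Lmul_Rmul a b : Lmul a \o Rmul b = Rmul b \o Lmul a.
Proof. by apply/funext => x; rewrite /Rmul /Lmul /= mulgA. Qed.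

Lemma Lmul1 : Lmul (1%g : G) = idfun.
Proof. by apply/funext => x; rewrite /Lmul mul1g. Qed.

Lemma Rmul1 : Rmul (1%g : G) = idfun.
Proof. by apply/funext => x; rewrite /Rmul mulg1. Qed.

Lemma tangent_LmulM a b x v :
  tangent (Lmul a) (b * x)%g (tangent (Lmul b) x v) = tangent (Lmul (a * b)%g) x v.
Proof.
by have := tangent_comp x v (smooth_Lmul b) (smooth_Lmul a); rewrite Lmul_comp.
Qed.

Lemma tangent_RmulM a b x v :
  tangent (Rmul a) (x * b)%g (tangent (Rmul b) x v) = tangent (Rmul (b * a)%g) x v.
Proof.
by have := tangent_comp x v (smooth_Rmul b) (smooth_Rmul a); rewrite Rmul_comp.
Qed.

Lemma tangent_Lmul_Rmul a b x v :
  tangent (Lmul a) (x * b)%g (tangent (Rmul b) x v) =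
  tangent (Rmul b) (a * x)%g (tangent (Lmul a) x v).
Proof.
have e1 := tangent_comp x v (smooth_Rmul b) (smooth_Lmul a).
have e2 := tangent_comp x v (smooth_Lmul a) (smooth_Rmul b).
rewrite Lmul_Rmul in e1; exact: etrans (esym e1) e2.
Qed.

Lemma tangent_left_invariant a b xi :
  tangent (Lmul b) a (left_invariant xi a) = left_invariant xi (b * a)%g.
Proof. by have := tangent_LmulM b a 1%g xi; rewrite mulg1. Qed.

Lemma tangent_Lmul1 v : tangent (Lmul (1%g : G)) 1%g v = v.
Proof. by rewrite Lmul1; exact: tangent_idfun. Qed.

Lemma tangent_Rmul1 v : tangent (Rmul (1%g : G)) 1%g v = v.
Proof. by rewrite Rmul1; exact: tangent_idfun. Qed.

Definition right_invariant v a : g := tangent (Rmul a) 1%g v.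

Lemma tangent_right_invariant a b v :
  tangent (Rmul b) a (right_invariant v a) = right_invariant v (a * b)%g.
Proof. by have := tangent_RmulM b a 1%g v; rewrite mul1g. Qed.

Definition maurer_cartan h : g -> g := tangent (Lmul h^-1%g) h.

Lemma maurer_cartan_left_invariant h xi :
  maurer_cartan h (left_invariant xi h) = xi.
Proof.
rewrite /maurer_cartan tangent_left_invariant mulVg /left_invariant Lmul1.
exact: tangent_idfun.
Qed.

Lemma left_invariant_maurer_cartan h w :
  left_invariant (maurer_cartan h w) h = w.
Proof.
have := tangent_LmulM h h^-1%g h w; rewrite mulVg mulgV Lmul1.
rewrite /left_invariant /maurer_cartan => ->; exact: tangent_idfun.
Qed.

(** Left translation by [(h * a)^-1] is translation by [h^-1] followed by [a^-1]. Moving right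
    translation by [a] past the former leaves conjugation by [a^-1] at the identity. *)
Lemma maurer_cartan_Rmul h a w :
  maurer_cartan (h * a)%g (tangent (Rmul a) h w) = Ad (a^-1)%g (maurer_cartan h w).
Proof.
rewrite /Ad (tangent_comp _ _ (smooth_Rmul _) (smooth_Lmul _)) invgK.
rewrite /maurer_cartan.
have := tangent_Lmul_Rmul h^-1%g a h w; rewrite mulVg => <-.
have := tangent_LmulM a^-1%g h^-1%g (h * a)%g (tangent (Rmul a) h w).
rewrite mulKg -invgM => <-.
by have -> : Rmul a 1%g = a by exact: mul1g.
Qed.

Lemma right_invariant_smooth v q x k : chart_dom (chart_at q) x ->
  Ck k (field_in_chart q (right_invariant v)) (chart_at q x).
Proof.
move=> qx.
have qx' : chart_dom (chart_at q) (1 * x)%g by rewrite mul1g.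
have := Ck_dloc_partiall v k (@lie_mul_smooth R n G) qx qx'; apply: Ck_ext.
have := image_chart_near qx; apply: filterS => _ [z qz <-].
rewrite /field_in_chart (chart_bwdK qz); symmetry.
exact: (tangent_in_chart v (smooth_Rmul z) (mul1g z) qz).
Qed.

Lemma left_invariant_smooth v q x k : chart_dom (chart_at q) x ->
  Ck k (field_in_chart q (left_invariant v)) (chart_at q x).
Proof.
move=> qx.
have qx' : chart_dom (chart_at q) (x * 1)%g by rewrite mulg1.
have := Ck_dloc_partialr v k (@lie_mul_smooth R n G) qx qx'; apply: Ck_ext.
have := image_chart_near qx; apply: filterS => _ [z qz <-].
rewrite /field_in_chart (chart_bwdK qz); symmetry.
exact: (tangent_in_chart v (smooth_Lmul z) (mulg1 z) qz).
Qed.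

(** Both the point and the vector are given in the one chart [q]; only in this form is regularity in
    the point meaningful. *)
Definition maurer_cartan_in_chart q (y : g) (w : g) : g :=
  let h := chart_bwd (chart_at q) y in maurer_cartan h (coord_change q h h w).

Lemma maurer_cartan_in_chartE q x w : chart_dom (chart_at q) x ->
  maurer_cartan_in_chart q (chart_at q x) w = maurer_cartan x (coord_change q x x w).
Proof. by move=> qx; rewrite /maurer_cartan_in_chart (chart_bwdK qx). Qed.

Lemma maurer_cartan_smooth q x w k : chart_dom (chart_at q) x ->
  Ck k (maurer_cartan_in_chart q ^~ w) (chart_at q x).
Proof.
move=> qx.
have x1 : chart_dom (chart_at (1%g : G)) (x^-1 * x)%g.
  by rewrite mulVg; exact: chart_at_dom.
have := Ck_dloc_diag w k (findim_rV n) (findim_rV n) (@lie_mul_smooth R n G)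
  (@lie_inv_smooth R n G) qx x1; apply: Ck_ext.
have := image_chart_near qx; apply: filterS => _ [z qz <-].
rewrite /maurer_cartan_in_chart (chart_bwdK qz) /=; symmetry.
exact: (tangent_coord_change w (smooth_Lmul z^-1%g) (mulVg z) qz).
Qed.

End LieGroupCalculus.

(** * Existence of the exponential map *)

Section Gluing.
Context {R : realType}.

(** Replaces one-sided limits at a breakpoint: [h] may switch between [f1] and [f2] in any way. *)
Lemma cvg_either (T : Type) (U : topologicalType) (F : set_system T)
    {FF : Filter F} (f1 f2 h : T -> U) (l : U) :
  f1 @ F --> l -> f2 @ F --> l ->
  (\forall x \near F, h x = f1 x \/ h x = f2 x) -> h @ F --> l.
Proof.
move=> c1 c2 hf A lA.
have F1 : \forall x \near F, A (f1 x) by exact: c1 _ lA.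
have F2 : \forall x \near F, A (f2 x) by exact: c2 _ lA.
have : \forall x \near F, A (h x).
  near=> x; have [->|->] : h x = f1 x \/ h x = f2 x by near: x.
    by near: x.
  by near: x.
exact.
Unshelve. all: by end_near. Qed.

Lemma is_derive_either (V : normedModType R) (f1 f2 h : R^o -> V) (t : R^o) v :
  is_derive t (1 : R^o) f1 v -> is_derive t (1 : R^o) f2 v ->
  f1 t = h t -> f2 t = h t ->
  (\forall s \near t, h s = f1 s \/ h s = f2 s) ->
  is_derive t (1 : R^o) h v.
Proof.
move=> d1 d2 e1 e2 hf.
have C (f : R^o -> V) : is_derive t (1 : R^o) f v ->
    (fun s : R => s^-1 *: (f (s *: (1 : R^o) + t) - f t)) @ 0^' --> v.
  by move=> [df <-]; exact: df.
have c : (fun s : R => s^-1 *: (h (s *: (1 : R^o) + t) - h t)) @ 0^' --> v.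
  apply: cvg_either (C _ d1) (C _ d2) _; rewrite e1 e2.
  have H : (fun s : R => s *: (1 : R^o) + t) @ 0^' --> t.
    rewrite -[X in _ --> X]add0r -[X in _ --> X + _](scale0r (1 : R^o)).
    apply: cvgD; last exact: cvg_cst.
    by apply: cvgZl; apply: cvg_within; exact: cvg_id.
  have := H _ hf; rewrite /nbhs /=.
  apply: filterS => s /= [->|->]; [by left|by right].
apply: DeriveDef.
  by apply/cvg_ex; exists v.
by apply/cvg_lim.
Qed.

Lemma has_velocity_either (E : normedModType R) (M : manifoldType E)
    (c1 c2 c : R -> M) (t : R) v :
  has_velocity c1 t v -> has_velocity c2 t v -> c1 t = c t -> c2 t = c t ->
  (\forall s \near t, c s = c1 s \/ c s = c2 s) ->
  has_velocity c t v.
Proof.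
move=> [k1 d1] [k2 d2] e1 e2 H; split.
  rewrite /prop_for /continuous_at; apply: (cvg_either (f1 := c1) (f2 := c2)) => //.
    by rewrite -e1.
  by rewrite -e2.
apply: (is_derive_either (f1 := chart_at (c t) \o c1) (f2 := chart_at (c t) \o c2)).
- by rewrite -{1}e1.
- by rewrite -{1}e2.
- by rewrite /= e1.
- by rewrite /= e2.
- by apply: filterS H => s /= [->|->]; [left|right].
Qed.

(** Serves twice: [a = 1] shifts time for the gluing, and [b = 0] rescales the curve for the
    exponential. *)
Lemma has_velocity_affine (E : normedModType R) (M : manifoldType E)
    (c : R -> M) (t a b : R) v :
  has_velocity c (a * t + b) v -> has_velocity (fun s => c (a * s + b)) t (a *: v).
Proof.
move=> [kc dc].
have [dfA e1] := diff_affine (L := *:%R a : {linear R^o -> R^o}) (b : R^o) (t : R^o)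
  (@scaler_continuous R R^o a).
split.
  apply: (@continuous_comp _ _ _ (fun s => a * s + b) c) => //.
  exact: (differentiable_continuous dfA).
have dfc : differentiable (chart_at (c (a * t + b)) \o c : R^o -> E) (a * t + b : R^o).
  by apply/derivable1_diffP; exact: ex_derive.
have D : differentiable ((chart_at (c (a * t + b)) \o c : R^o -> E) \o
    (fun s : R^o => a * s + b : R^o)) (t : R^o) by exact: differentiable_comp.
apply: DeriveDef; first exact/derivable1_diffP.
rewrite deriveE // (diff_comp dfA dfc) /= e1 /=.
by rewrite linearZ /= -deriveE // derive_val.
Qed.

Lemma has_velocity_in_chart (E : normedModType R) (M : manifoldType E)
    (p x : M) (y : R -> E) (t : R) v :
  chart_dom (chart_at p) x -> y t = chart_at p x ->
  is_derive (t : R^o) (1 : R^o) (y : R^o -> E) (coord_change x p x v) ->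
  has_velocity (chart_bwd (chart_at p) \o y) t v.
Proof.
move=> px yt dy.
have dfy : differentiable (y : R^o -> E) (t : R^o).
  by apply/derivable1_diffP; exact: ex_derive.
have e1 : 'd (y : R^o -> E) (t : R^o) (1 : R^o) = coord_change x p x v.
  by rewrite -deriveE // derive_val.
have bt : chart_bwd (chart_at p) (y t) = x by rewrite yt chart_bwdK.
split.
  apply: continuous_comp; first exact: (differentiable_continuous dfy).
  by rewrite /prop_for /continuous_at bt yt; exact: chart_bwd_cvg.
have dl := smooth_loc_diff (@smooth_map_id R E M) px (chart_at_dom x).
have dl' : differentiable (loc (@idfun M) p x) (y t) by rewrite yt.
have D : differentiable (loc (@idfun M) p x \o (y : R^o -> E)) (t : R^o).
  exact: differentiable_comp.
rewrite [X in is_derive _ _ (chart_at X \o _) _]/= bt.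
apply: DeriveDef; first exact/derivable1_diffP.
rewrite deriveE; last exact: D.
rewrite (@diff_comp _ _ _ _ y (loc idfun p x) t dfy dl') /= e1 yt.
have dx := chart_at_dom x.
exact: etrans (coord_change_comp v dx px dx) (coord_change_id v dx).
Qed.

Lemma has_velocity_field (E : normedModType R) (M : manifoldType E)
    (X : M -> E) (p : M) (y : R -> E) (t : R) :
  (chart_at p @` chart_dom (chart_at p)) (y t) ->
  is_derive (t : R^o) (1 : R^o) (y : R^o -> E) (field_in_chart p X (y t)) ->
  has_velocity (chart_bwd (chart_at p) \o y) t
    (X ((chart_bwd (chart_at p) \o y) t)).
Proof.
move=> [x px xy] dy; have bt : chart_bwd (chart_at p) (y t) = x.
  by rewrite -xy chart_bwdK.
rewrite [X in is_derive _ _ _ X]/field_in_chart bt in dy.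
by have := has_velocity_in_chart px (esym xy) dy; rewrite /= bt.
Qed.

End Gluing.

(** * From local integral curves to the exponential *)

Section Exponential.
Context {R : realType} {n : nat} {G : lieGroupType R n}.
Local Notation g := 'rV[R]_n.
Implicit Types (xi : g).

Lemma left_invariantZ xi (k : R) (a : G) :
  left_invariant (k *: xi) a = k *: left_invariant xi a.
Proof. by rewrite /left_invariant /tangent linearZ. Qed.

Lemma local_integral_curve xi : exists2 c : R -> G, c 0 = 1%g &
  exists2 d : R, 0 < d &
    forall t, `|t| < d -> has_velocity c t (left_invariant xi (c t)).
Proof.
have d1 := chart_at_dom (1%g : G).
have [y y0 dy] := picard_C1 (left_invariant_smooth xi 1 d1).
exists (chart_bwd (chart_at (1%g : G)) \o y); first by rewrite /= y0 chart_bwdK.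
have cy0 : {for 0, continuous y}.
  apply: differentiable_continuous; apply/derivable1_diffP.
  exact: (@ex_derive _ _ _ _ _ _ _ (nbhs_singleton dy)).
have N : \forall t \near (0 : R),
    is_derive t (1 : R) y (field_in_chart (1%g : G) (left_invariant xi) (y t)) /\
    (chart_at (1%g : G) @` chart_dom (chart_at (1%g : G))) (y t).
  have H := image_chart_near d1; rewrite -y0 in H.
  exact: (filterI dy (cy0 _ H)).
have [d /= d0 dN] := (nbhs_normP _ _).1 N.
exists d => // t td.
have [|dyt zy] := dN t; first by rewrite /= sub0r normrN.
exact: (has_velocity_field zy dyt).
Qed.

Definition zpowg (a : G) (k : int) : G :=
  match k with Posz m => (a ^+ m)%g | Negz m => (a ^- m.+1)%g end.

Lemma zpowgD1 a k : zpowg a (k + 1) = (zpowg a k * a)%g.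
Proof.
case: k => [m|[|m]].
- by have -> : Posz m + 1 = Posz m.+1 by [rewrite -addn1 PoszD]; rewrite /= expgSr.
- by rewrite /= expg1 mulVg.
- have -> : Negz m.+1 + 1 = Negz m.
    by rewrite !NegzE -[m.+2]addn1 PoszD opprD subrK.
  by rewrite /= [in RHS]expgS invgM -mulgA mulVg mulg1.
Qed.

Lemma has_velocity_translate (c : R -> G) (a : G) xi (t b : R) :
  has_velocity c (t + b) (left_invariant xi (c (t + b))) ->
  has_velocity (fun s => a * c (s + b))%g t (left_invariant xi (a * c (t + b))%g).
Proof.
move=> H; rewrite -tangent_left_invariant.
have H1 : has_velocity (fun s => c (1 * s + b)) t
    (1 *: left_invariant xi (c (t + b))).
  by apply: has_velocity_affine; rewrite mul1r.
have := has_velocity_comp (smooth_Lmul a) H1; rewrite mul1r scale1r.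
have -> : Lmul a \o (fun s => c (1 * s + b)) = (fun s => a * c (s + b))%g.
  by apply/funext => s; rewrite /= mul1r.
exact.
Qed.

Lemma integral_curve xi : exists2 c : R -> G, c 0 = 1%g &
  forall t, has_velocity c t (left_invariant xi (c t)).
Proof.
have [c c0 [d d0 dc]] := local_integral_curve xi.
(* Intervals of length [e] are half as long as the reach [d] of the local curve, so each piece also
   solves the equation around both ends of its interval. *)
pose e := d / 2; have e0 : 0 < e by rewrite divr_gt0.
pose k t := Num.floor (t / e).
(* The local curve restarted at time [m * e] from the point [c e] to the power [m]; one factor [c e]
   per interval makes consecutive pieces meet. *)
pose piece (m : int) t := (zpowg (c e) m * c (t - m%:~R * e))%g.
have pieceS (m : int) : piece m ((m + 1)%:~R * e) = piece (m + 1) ((m + 1)%:~R * e).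
  by rewrite /piece subrr c0 mulg1 zpowgD1 intrD mulrDl mul1r addrAC subrr add0r.
have dpiece m t : `|t - m%:~R * e| < d ->
    has_velocity (piece m) t (left_invariant xi (piece m t)).
  by move=> td; apply: has_velocity_translate; exact: dc.
have ed : d = 2 * e by rewrite /e; lra.
have kP t : (k t)%:~R * e <= t < (k t + 1)%:~R * e.
  by rewrite -ler_pdivlMr // -ltr_pdivrMr // floor_itv.
have kE t m : m%:~R * e <= t -> t < (m + 1)%:~R * e -> k t = m.
  move=> h1 h2; apply: floor_def.
  by rewrite ler_pdivlMr // ltr_pdivrMr // h1 h2.
exists (fun t => piece (k t) t).
  by rewrite /k mul0r floor0 /piece /= mul0r subrr c0 mulg1.
move=> t; set m := k t; have /andP[mt tm] := kP t; rewrite -/m in mt tm.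
have tm1 : t < m%:~R * e + e by move: tm; rewrite intrD mulrDl mul1r.
have d1 : `|t - m%:~R * e| < d by rewrite ger0_norm ?subr_ge0 // ed; lra.
have N1 : \forall s \near t, s < (m + 1)%:~R * e.
  by apply: open_nbhs_nbhs; split => //; exact: open_lt.
(* Inside an interval the index [k] is locally constant and a single piece suffices; otherwise [t]
   is the breakpoint [m * e]. *)
have [mt'|mt'] := ltP (m%:~R * e) t.
  apply: (has_velocity_either (dpiece m t d1) (dpiece m t d1)) => //.
  have N2 : \forall s \near t, m%:~R * e < s.
    by apply: open_nbhs_nbhs; split => //; exact: open_gt.
  near=> s; left; rewrite (kE s m) //; last by near: s.
  by apply: ltW; near: s.
have te : t = m%:~R * e by apply/eqP; rewrite eq_le mt mt'.
have mE : m = (m - 1) + 1 by rewrite subrK.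
have te' : t = ((m - 1) + 1)%:~R * e by rewrite -mE.
(* The two pieces meeting at the breakpoint have the same value, hence by [dpiece] the same
   velocity. *)
have pm : piece (m - 1) t = piece m t.
  by rewrite {1}te' pieceS -mE -te.
have d2 : `|t - (m - 1)%:~R * e| < d.
  by rewrite te intrB mulrBl mul1r subKr gtr0_norm // ed; lra.
have H2 := dpiece (m - 1) t d2; rewrite pm in H2.
apply: (has_velocity_either (dpiece m t d1) H2) => //.
have N2 : \forall s \near t, (m - 1)%:~R * e < s.
  apply: open_nbhs_nbhs; split; first exact: open_gt.
  by rewrite /= te intrB mulrBl mul1r; lra.
near=> s; have [ms|ms] := leP (m%:~R * e) s.
  left; rewrite (kE s m) //; by near: s.
right; rewrite (kE s (m - 1)) ?subrK //.
by apply: ltW; near: s.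
Unshelve. all: by end_near. Qed.

Lemma is_lie_exp_exists : exists e : g -> G, is_lie_exp e.
Proof.
have /choice[c cP] : forall xi, exists c : R -> G, c 0 = 1%g /\
    forall t, has_velocity c t (left_invariant xi (c t)).
  by move=> xi; have [c c0 dc] := integral_curve xi; exists c.
(* [pick] depends only on which coordinates are nonzero, so [xi] and [s *: xi] use the same index
   for nonzero [s]. Hence [coef] is homogeneous and [dir] is constant on each line with 0
   removed. *)
pose coef (xi : g) : R := if [pick i | xi ord0 i != 0] is Some i then xi ord0 i else 0.
pose dir (xi : g) : g := (coef xi)^-1 *: xi.
have coef0 : coef 0 = 0.
  by rewrite /coef; case: pickP => // i; rewrite mxE eqxx.
have coefZ (s : R) xi : s != 0 -> coef (s *: xi) = s * coef xi.
  move=> s0; rewrite /coef (eq_pick (Q := fun i => xi ord0 i != 0)).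
    by case: pickP => [i _|_]; rewrite ?mxE ?mulr0.
  by move=> i; rewrite !mxE mulf_eq0 (negbTE s0).
have dirZ (s : R) xi : s != 0 -> dir (s *: xi) = dir xi.
  by move=> s0; rewrite /dir coefZ // scalerA invfM mulrAC mulVf ?mul1r.
have coef_dir xi : coef xi *: dir xi = xi.
  rewrite /dir scalerA; have [c0|c0] := eqVneq (coef xi) 0; last first.
    by rewrite divff // scale1r.
  suff -> : xi = 0 by rewrite scaler0.
  apply/rowP => i; rewrite mxE; move: c0; rewrite /coef; case: pickP.
    by move=> j /eqP.
  by move=> /(_ i)/negbFE/eqP.
(* Choosing one generator on each line of g gives e (s xi) = c (dir xi) (s coef xi)
   without appealing to the uniqueness of integral curves. *)
exists (fun xi => c (dir xi) (coef xi)); split.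
  by rewrite coef0; case: (cP (dir 0)).
move=> xi t.
have cE : (fun s : R => c (dir (s *: xi)) (coef (s *: xi))) =
          (fun s => c (dir xi) (coef xi * s + 0)).
  (* At [s = 0] the direction jumps to [dir 0], but every chosen curve is at 1 at time 0. *)
  apply/funext => s; rewrite addr0; have [->|s0] := eqVneq s 0.
    by rewrite scale0r coef0 mulr0; case: (cP (dir 0)) => ->; case: (cP (dir xi)) => ->.
  by rewrite dirZ // coefZ // mulrC.
have ct := congr1 (@^~ t) cE; rewrite /= in ct.
have e (a : G) : left_invariant xi a = coef xi *: left_invariant (dir xi) a.
  by rewrite -left_invariantZ coef_dir.
rewrite ct cE e.
by apply: has_velocity_affine; case: (cP (dir xi)).
Qed.

Lemma lie_expP : is_lie_exp (@lie_exp R n G).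
Proof. exact: (xgetPex _ is_lie_exp_exists). Qed.

End Exponential.

(** * The natural connection *)

Section Products.
Context {R : realType}.
Implicit Types E F H K : normedModType R.

(** The charts of a product are products of charts by construction, so the local expression is
    itself a product map. *)
Lemma tangent_prod_map E F H K (M : manifoldType E) (N : manifoldType F)
    (M' : manifoldType H) (N' : manifoldType K) (f : M -> M') (h : N -> N') p v :
  smooth_map f -> smooth_map h ->
  tangent (fun z : M * N => (f z.1, h z.2)) p v =
  (tangent f p.1 v.1, tangent h p.2 v.2).
Proof.
move=> sf sh.
have df := smooth_loc_diff sf (chart_at_dom p.1) (chart_at_dom (f p.1)).
have dh := smooth_loc_diff sh (chart_at_dom p.2) (chart_at_dom (h p.2)).
exact: (@diff_prod_map _ _ _ _ _ _ _ (chart_at p.1 p.1, chart_at p.2 p.2) df dh).2.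
Qed.

Lemma coord_change_prod E F (M : manifoldType E) (N : manifoldType F)
    (p q x : M * N) v :
  chart_dom (chart_at p) x -> chart_dom (chart_at q) x ->
  coord_change p q x v =
  (coord_change p.1 q.1 x.1 v.1, coord_change p.2 q.2 x.2 v.2).
Proof.
move=> [p1 p2] [q1 q2].
have d1 := smooth_loc_diff (@smooth_map_id R E M) p1 q1.
have d2 := smooth_loc_diff (@smooth_map_id R F N) p2 q2.
exact: (@diff_prod_map _ _ _ _ _ _ _ (chart_at p.1 x.1, chart_at p.2 x.2) d1 d2).2.
Qed.

Lemma tangent_fst E F (M : manifoldType E) (N : manifoldType F) (p : M * N) w :
  tangent (fun z : M * N => z.1) p w = w.1.
Proof.
have l1 : linear (fun z : E * F => z.1) by [].
pose p1 : {linear (E * F)%type -> E} := HB.pack (fun z : E * F => z.1)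
  (GRing.isLinear.Build _ _ _ _ _ l1).
have c1 : continuous p1 by move=> y; exact: cvg_fst.
have d1 := linear_differentiable (chart_at p p) c1.
have d := smooth_loc_diff (@smooth_map_id R E M) (chart_at_dom p.1) (chart_at_dom p.1).
have := @diff_comp _ _ _ _ p1 (loc idfun p.1 p.1) (chart_at p p) d1 d.
move/(congr1 (@^~ w)) => /= H1; apply: etrans H1 _.
by rewrite (diff_lin _ c1); exact: tangent_idfun.
Qed.

Lemma tangent_section E F (M : manifoldType E) (N : manifoldType F) (b : N)
    (x : M) v : tangent (fun x : M => (x, b)) x v = (v, 0).
Proof.
have d1 := smooth_loc_diff (@smooth_map_id R E M) (chart_at_dom x) (chart_at_dom x).
have d2 := @differentiable_cst _ E F (chart_at b b) (chart_at x x).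
have e2 : 'd (fun=> chart_at b b) (chart_at x x) v = 0.
  by rewrite (diff_cst (chart_at b b) (chart_at x x)).
have := diff_pair d1 d2.
move/(congr1 (@^~ v)) => /= H1; apply: etrans H1 _.
by congr pair; [exact: tangent_idfun|exact: e2].
Qed.

Lemma velocity_pair_cst E F (M : manifoldType E) (N : manifoldType F) (x : M)
    (c : R -> N) (t : R) v :
  has_velocity c t v -> velocity (fun s => (x, c s)) t = (0, v).
Proof.
move=> [_ dc].
have dfc : differentiable (chart_at (c t) \o c : R^o -> F) (t : R^o).
  by apply/derivable1_diffP; exact: ex_derive.
have e1 : 'd (chart_at (c t) \o c : R^o -> F) (t : R^o) (1 : R^o) = v.
  by rewrite -deriveE // derive_val.
have d0 := @differentiable_cst _ R^o E (chart_at x x) (t : R^o).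
have e0 : 'd (fun=> chart_at x x) (t : R^o) (1 : R^o) = 0.
  by rewrite (diff_cst (chart_at x x) (t : R^o)).
rewrite /velocity deriveE; last exact: (differentiable_pair d0 dfc).
have := diff_pair d0 dfc; move/(congr1 (@^~ (1 : R^o))) => /= H1.
apply: etrans H1 _; by congr pair.
Qed.

Lemma diff_fun_cst E F (c : F) (x v : E) : 'd (fun=> c) x v = 0.
Proof. by rewrite (diff_cst c x). Qed.

Lemma field_in_chartN E (M : manifoldType E) q (X : M -> E) y :
  field_in_chart q (fun a => - X a) y = - field_in_chart q X y.
Proof. by rewrite /field_in_chart /coord_change linearN. Qed.

Lemma field_bracketNN E (M : manifoldType E) (X Y : M -> E) p :
  differentiable (field_in_chart p X) (chart_at p p) ->
  differentiable (field_in_chart p Y) (chart_at p p) ->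
  field_bracket (fun a => - X a) (fun a => - Y a) p = field_bracket X Y p.
Proof.
move=> dX dY; rewrite /field_bracket.
have e Z : field_in_chart p (fun a : M => - Z a) = - field_in_chart p Z.
  by apply/funext => y; exact: field_in_chartN.
have eN (Z : M -> E) u : differentiable (field_in_chart p Z) (chart_at p p) ->
    'd (- field_in_chart p Z) (chart_at p p) (- u) =
    'd (field_in_chart p Z) (chart_at p p) u.
  move=> dZ; have -> := diffN dZ.
  by rewrite -[LHS]/(- ('d (field_in_chart p Z) (chart_at p p) (- u))) linearN opprK.
by rewrite (e X) (e Y); congr (_ - _); [exact: eN|exact: eN].
Qed.

Lemma field_bracketC E (M : manifoldType E) (X Y : M -> E) p :
  field_bracket Y X p = - field_bracket X Y p.
Proof. by rewrite /field_bracket opprB. Qed.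

Lemma tangent_linear E F (M : manifoldType E) (N : manifoldType F) (f : M -> N) p :
  linear (tangent f p).
Proof. by move=> a u v; rewrite /tangent linearP. Qed.

Lemma tangent0 E F (M : manifoldType E) (N : manifoldType F) (f : M -> N) p :
  tangent f p 0 = 0.
Proof. by rewrite /tangent linear0. Qed.

Lemma tangentB E F (M : manifoldType E) (N : manifoldType F) (f : M -> N) p u v :
  tangent f p (u - v) = tangent f p u - tangent f p v.
Proof. by rewrite /tangent linearB. Qed.

Lemma coord_change_linear E (M : manifoldType E) (p q x : M) :
  linear (coord_change p q x).
Proof. by move=> a u v; rewrite /coord_change linearP. Qed.

Lemma tangent_prod_mapr E F K (M : manifoldType E) (N : manifoldType F)
    (N' : manifoldType K) (h : N -> N') p v : smooth_map h ->
  tangent (fun z : M * N => (z.1, h z.2)) p v = (v.1, tangent h p.2 v.2).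
Proof.
move=> sh; apply: etrans (tangent_prod_map p v (@smooth_map_id R E M) sh) _.
by rewrite tangent_idfun.
Qed.

Lemma Ck_snd E F H k (f : F -> H) (z : E * F) :
  Ck k f z.2 -> Ck k (fun y : E * F => f y.2) z.
Proof.
have <- : @snd_lin R E F z + 0 = z.2 by rewrite addr0.
move/(Ck_affine (@snd_lin_continuous R E F)); apply: Ck_ext.
by near=> y; rewrite addr0.
Unshelve. all: by end_near. Qed.

Lemma field_in_chart_prod E F (M : manifoldType E) (N : manifoldType F)
    (A : M -> E) (X : N -> F) (q x : M * N) : chart_dom (chart_at q) x ->
  field_in_chart q (fun p => (A p.1, X p.2)) (chart_at q x) =
  (field_in_chart q.1 A (chart_at q.1 x.1), field_in_chart q.2 X (chart_at q.2 x.2)).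
Proof.
move=> qx; have [q1 q2] := qx; rewrite /field_in_chart !chart_bwdK //.
exact: (coord_change_prod _ (chart_at_dom x) qx).
Qed.

Lemma Ck_field_prod E F (M : manifoldType E) (N : manifoldType F)
    (A : M -> E) (X : N -> F) (q x : M * N) k : chart_dom (chart_at q) x ->
  Ck k (field_in_chart q.1 A) (chart_at q.1 x.1) ->
  Ck k (field_in_chart q.2 X) (chart_at q.2 x.2) ->
  Ck k (field_in_chart q (fun p => (A p.1, X p.2))) (chart_at q x).
Proof.
move=> qx CA CX.
have := @Ck_prod_map _ _ _ _ _ k _ _ (chart_at q x) CA CX; apply: Ck_ext.
have := image_chart_near qx; apply: filterS => _ [z qz <-].
by rewrite field_in_chart_prod.
Qed.

(** A graph over the model space inherits the standard basis: the first component gives injectivity,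
    and the range is the whole graph. *)
Lemma lincomb_graph m F (L : 'rV[R]_m -> F) (a : 'rV[R]_m) : linear L ->
  lincomb (fun i => (delta_mx ord0 i, L (delta_mx ord0 i)) : 'rV[R]_m * F) a =
  (a, L a).
Proof.
move=> lL; pose L' : {linear 'rV[R]_m -> F} := HB.pack L
  (GRing.isLinear.Build _ _ _ _ _ lL).
have eL : L a = \sum_i a ord0 i *: L (delta_mx ord0 i).
  rewrite {1}(row_sum_delta a) -[L]/(L' : _ -> _) linear_sum.
  by apply: eq_bigr => i _; rewrite linearZ.
transitivity (\sum_i a ord0 i *: delta_mx ord0 i : 'rV[R]_m,
              \sum_i a ord0 i *: L (delta_mx ord0 i)).
  rewrite /lincomb; elim/big_rec3: _ => [|i u v w _ ->] //.
by rewrite -eL -row_sum_delta.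
Qed.

End Products.

(** * The natural connection and its connection form *)

Section NaturalConnectionTheory.
Context {R : realType} {n : nat} (G : lieGroupType R n).
Local Notation g := 'rV[R]_n.
Local Notation P := (g * G)%type.
Implicit Types (p : P) (a h : G) (v xi eta : g) (w : (g * g)%type).

Lemma tangent_bundle_act a p w :
  tangent (bundle_act G ^~ a) p w = (w.1, tangent (Rmul a) p.2 w.2).
Proof. exact: (tangent_prod_mapr p w (smooth_Rmul a)). Qed.

Lemma tangent_bundle_proj p w : tangent (bundle_proj G) p w = w.1.
Proof. exact: tangent_fst. Qed.

Lemma tangent_id_section x v : tangent (id_section G) x v = (v, 0).
Proof. exact: tangent_section. Qed.

Lemma natural_horizontalE p w :
  natural_horizontal G p w <-> w.2 = right_invariant w.1 p.2.
Proof.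
by case: w => w1 w2; split=> [[v _ [<- <-]]//|/= ->]; exists w1.
Qed.

Lemma natural_horizontal_graph p v :
  natural_horizontal G p (v, right_invariant v p.2).
Proof. by exists v. Qed.

Definition natural_frame (i : 'I_n) : P -> g * g :=
  fun p => (delta_mx ord0 i, right_invariant (delta_mx ord0 i) p.2).

Lemma natural_frame_smooth i : smooth_field_on setT (natural_frame i).
Proof.
move=> q _ [x [qx _] <-] k; apply: (@Ck_field_prod R g g g G
  (fun=> delta_mx ord0 i) (right_invariant (delta_mx ord0 i)) q x k qx).
  (* On the vector space factor all charts are the identity chart, so a constant field has a
     constant expression. *)
  have := Ck_cst k (delta_mx ord0 i : g) (chart_at q.1 x.1); apply: Ck_ext.
  near=> y; symmetry; exact: (@coord_change_id _ _ _ q.1 y _ I).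
exact: (right_invariant_smooth _ _ qx.2).
Unshelve. all: by end_near. Qed.

Lemma natural_horizontal_smooth : smooth_distribution (natural_horizontal G).
Proof.
split=> p.
  split; first by apply/natural_horizontalE; rewrite /right_invariant tangent0.
  move=> a u v /natural_horizontalE uE /natural_horizontalE vE.
  apply/natural_horizontalE; rewrite /= uE vE.
  by rewrite /right_invariant tangent_linear.
exists n, setT, natural_frame; split => //; first exact: openT.
  exact: natural_frame_smooth.
move=> x _.
have E v : lincomb (natural_frame ^~ x) v = (v, right_invariant v x.2).
  exact: (lincomb_graph v (tangent_linear _ _)).
split=> [a b|]; first by rewrite !E => -[].
apply/seteqP; split=> [_ [a _ <-]|_ [a _ <-]]; first by rewrite E; exists a.
by exists a => //; rewrite E.
Qed.

Lemma natural_is_connection :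
  is_connection (bundle_proj G) (bundle_act G) (natural_horizontal G).
Proof.
split; first exact: natural_horizontal_smooth.
- move=> p; apply/seteqP; split=> [w [/natural_horizontalE wE]|w ->].
    rewrite /vertical /= tangent_bundle_proj => w1.
    by case: w wE w1 => w1 w2 /= -> ->; rewrite /right_invariant tangent0.
  split; first by apply/natural_horizontalE; rewrite /right_invariant tangent0.
  by rewrite /vertical /= tangent_bundle_proj.
- move=> p; apply/seteqP; split=> // w _.
  (* The first component of [w] determines its horizontal part; the rest has first component 0 and
     is vertical. *)
  exists (w.1, right_invariant w.1 p.2); first exact: natural_horizontal_graph.
  exists (0, w.2 - right_invariant w.1 p.2).
    by rewrite /vertical /= tangent_bundle_proj.
  by case: w => w1 w2; congr pair; rewrite /= ?addr0 // addrC subrK.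
- move=> p a; apply/seteqP.
  split=> [w /natural_horizontalE wE|_ [w /natural_horizontalE wE <-]].
    exists (w.1, right_invariant w.1 p.2); first exact: natural_horizontal_graph.
    apply: etrans (tangent_bundle_act a p _) _.
    case: w wE => w1 w2 /= ->; congr pair; exact: tangent_right_invariant.
  apply/natural_horizontalE; rewrite tangent_bundle_act [LHS]/= wE.
  exact: tangent_right_invariant.
Qed.

Lemma fundamental_fieldE xi p :
  fundamental_field (bundle_act G) xi p = (0, left_invariant xi p.2).
Proof.
have [e0 ev] := lie_expP (G := G).
(* In the group factor the curve is the left translate by [p.2] of the exponential curve, whose
   velocity at time 0 is known. *)
have H := has_velocity_comp (smooth_Lmul p.2) (ev xi 0).
apply: etrans (velocity_pair_cst p.1 H) _.
by rewrite tangent_left_invariant scale0r e0 mulg1.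
Qed.

Definition natural_form p (w : g * g) : g :=
  maurer_cartan p.2 (w.2 - right_invariant w.1 p.2).

Lemma natural_form_linear p : linear (natural_form p).
Proof.
move=> a u v; rewrite /natural_form /maurer_cartan -tangent_linear; congr (tangent _ _ _).
rewrite /right_invariant /= tangent_linear.
by rewrite opprD addrACA scalerBr.
Qed.

(** [maurer_cartan_smooth] keeps the vector fixed, whereas the form is also applied to the
    right-invariant field, whose coordinates move with the point; the expansion reduces this to
    fixed vectors. *)
Lemma maurer_cartan_in_chart_sum q y v :
  maurer_cartan_in_chart q y v =
  \sum_i v ord0 i *: maurer_cartan_in_chart (G := G) q y (delta_mx ord0 i).
Proof.
have l : linear (maurer_cartan_in_chart q y).
  move=> a u u'; rewrite /maurer_cartan_in_chart coord_change_linear.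
  exact: tangent_linear.
by have := lincomb_graph v l; rewrite /lincomb => /(congr1 snd) /= <-; rewrite raddf_sum.
Qed.

Lemma natural_form_in_chart (q x : P) w : chart_dom (chart_at q) x ->
  natural_form x (coord_change q x x w) =
  maurer_cartan_in_chart q.2 (chart_at q.2 x.2) w.2 -
  maurer_cartan_in_chart q.2 (chart_at q.2 x.2)
    (field_in_chart q.2 (right_invariant w.1) (chart_at q.2 x.2)).
Proof.
move=> qx; have [q1 q2] := qx; have x2 := chart_at_dom x.2.
have E1 : coord_change q x x w = (w.1, coord_change q.2 x.2 x.2 w.2).
  apply: etrans (coord_change_prod _ qx (chart_at_dom x)) _.
  by congr pair; exact: (@coord_change_id _ _ _ q.1 _ _ I).
have E2 : coord_change q.2 x.2 x.2
    (coord_change x.2 q.2 x.2 (right_invariant w.1 x.2)) = right_invariant w.1 x.2.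
  exact: (coord_changeK (right_invariant w.1 x.2) x2 q2).
rewrite E1 !(maurer_cartan_in_chartE _ q2) (field_in_chartE _ q2) E2.
exact: tangentB.
Qed.

Lemma natural_form_smooth : smooth_form natural_form.
Proof.
split; first exact: natural_form_linear.
move=> q w _ [x qx <-] k.
have CM v' := maurer_cartan_smooth v' k qx.2.
have CR := right_invariant_smooth w.1 k qx.2.
have CMR : Ck k (fun y => \sum_i field_in_chart q.2 (right_invariant w.1) y ord0 i *:
    maurer_cartan_in_chart q.2 y (delta_mx ord0 i)) (chart_at q.2 x.2).
  apply: Ck_sum => i; apply: Ck_scale (CM _).
  exact: (Ck_lin (L := coordl i) (@coord_continuous _ _ _ _ _) CR).
(* In a product chart the expression of the form depends on the group coordinate alone. *)
have := @Ck_snd R g g g k _ (chart_at q x) (Ck_sub (CM w.2) CMR); apply: Ck_ext.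
have := image_chart_near qx; apply: filterS => _ [z qz <-].
rewrite (chart_bwdK qz); apply: etrans _ (esym (natural_form_in_chart w qz)).
by rewrite [X in _ = _ - X]maurer_cartan_in_chart_sum.
Qed.

Lemma natural_form_act a p w :
  pullback (bundle_act G ^~ a) natural_form p w = Ad a^-1%g (natural_form p w).
Proof.
rewrite /pullback tangent_bundle_act /natural_form -maurer_cartan_Rmul.
by rewrite tangentB tangent_right_invariant.
Qed.

Lemma natural_form_is_connection_form :
  is_connection_form (bundle_act G) (natural_horizontal G) natural_form.
Proof.
split; first exact: natural_form_smooth.
- move=> p; apply/seteqP; split=> w.
    move=> /natural_horizontalE wE.
    by rewrite /= /natural_form wE subrr; exact: tangent0.
  move=> /= w0; apply/natural_horizontalE; apply/eqP; rewrite -subr_eq0.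
  (* [maurer_cartan] is injective, left translation being its inverse, so the kernel is exactly the
     horizontal space. *)
  rewrite -(left_invariant_maurer_cartan p.2 (w.2 - _)).
  by rewrite -/(natural_form p w) w0; apply/eqP; exact: tangent0.
- move=> xi p; rewrite fundamental_fieldE /natural_form /=.
  rewrite /right_invariant tangent0 subr0.
  exact: maurer_cartan_left_invariant.
- move=> a p w; exact: natural_form_act.
Qed.

Lemma pullback_connection_form alpha :
  is_connection_form (bundle_act G) (natural_horizontal G) alpha ->
  pullback (id_section G) alpha = fun _ v => - v.
Proof.
move=> [[al _] aH aF _]; apply/funext => x; apply/funext => v.
rewrite /pullback tangent_id_section.
set p := id_section G x.
have a1 : alpha p (v, v) = 0.
  have : natural_horizontal G p (v, v).
    by apply/natural_horizontalE; rewrite /= /right_invariant; symmetry; exact: tangent_Rmul1.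
  by rewrite aH.
have a2 : alpha p (0, v) = v.
  have := aF v p; rewrite fundamental_fieldE.
  have -> // : left_invariant v p.2 = v.
  exact: tangent_Lmul1.
have e : (v, 0) = -1 *: (0, v) + (v, v) :> g * g.
  by rewrite scaleN1r; congr pair; rewrite /= ?oppr0 ?add0r // addrC subrr.
by rewrite e al a1 a2 scaleN1r addr0.
Qed.

(** Each term of the bracket differentiates one field along the other, so the two signs cancel;
    differentiability of the fields in the chart at 1 lets the sign out of the derivative. *)
Lemma lie_bracketNN xi eta : lie_bracket G (- xi) (- eta) = lie_bracket G xi eta.
Proof.
have lN v : left_invariant (G := G) (- v) = (fun a => - left_invariant v a).
  by apply/funext => a; rewrite -scaleN1r left_invariantZ scaleN1r.
have d v : differentiable (field_in_chart (1%g : G) (left_invariant v))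
    (chart_at (1%g : G) 1%g).
  exact: CkS_differentiable (left_invariant_smooth v 1 (chart_at_dom (1%g : G))).
rewrite /lie_bracket !lN.
exact: (field_bracketNN (d xi) (d eta)).
Qed.

Lemma lie_bracketC xi eta : lie_bracket G eta xi = - lie_bracket G xi eta.
Proof. exact: field_bracketC. Qed.

End NaturalConnectionTheory.

Theorem theorem1 (R : realType) (n : nat) (G : lieGroupType R n) :
  is_connection (bundle_proj G) (bundle_act G) (natural_horizontal G) /\
  (exists alpha, is_connection_form (bundle_act G)
                   (natural_horizontal G) alpha) /\
  forall alpha, is_connection_form (bundle_act G)
                  (natural_horizontal G) alpha ->
    forall x xi eta : 'rV[R]_n,
      curvature G (pullback (id_section G) alpha) x xi eta =
      lie_bracket G xi eta.
Proof.
split; first exact: natural_is_connection.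
split; first by exists (natural_form (G := G)); exact: natural_form_is_connection_form.
move=> alpha /pullback_connection_form -> x xi eta.
have d0 (v u : 'rV[R]_n) : ext_deriv (fun _ : 'rV[R]_n => -%R) x v u = 0.
  rewrite /ext_deriv; apply/eqP; rewrite subr_eq0; apply/eqP.
  exact: etrans (diff_fun_cst _ _ _) (esym (diff_fun_cst _ _ _)).
rewrite /curvature d0 add0r /form_bracket !lie_bracketNN (lie_bracketC G xi eta).
by rewrite opprK scalerDr -scalerDl -[2^-1]mul1r -splitr scale1r.
Qed.
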